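(* Let $\mathcal{S}$ be a recognizable substitution with minimal subshift and let $\Phi:(\Sigma,\mu)\to([0,1],m)$ be a canonical isomorphism given by a dual substitution $\mathcal{S}_*$, where $m$ is Lebesgue measure. Then the infinite interval exchange transformation $\mathfrak{F}$ given by $\mathcal{S}_*$ is defined almost everywhere on $[0,1]$, and $\Phi$ is a measurable conjugacy between $(\Sigma,\sigma,\mu)$ and $([0,1],\mathfrak{F},m)$ (that is, $\Phi$ is measure preserving, bijective almost everywhere, and $\Phi\circ\sigma=\mathfrak{F}\circ\Phi$ $\mu$-almost everywhere).
   Context: **Substitutions.** A substitution $\mathcal{S}$ on a finite alphabet $\mathcal{A}$ assigns to each $\alpha\in\mathcal{A}$ a nonempty finite word $\mathcal{S}(\alpha)=\mathcal{S}(\alpha)(0)\,\mathcal{S}(\alpha)(1)\cdots\mathcal{S}(\alpha)(|\mathcal{S}(\alpha)|-1)$ over $\mathcal{A}$; it extends to words by concatenation, which defines $\mathcal{S}^n(\alpha)$. Let $\mathcal{L}$ be the set of all subwords of all words $\mathcal{S}^n(\alpha)$, and let $\Sigma\subset\mathcal{A}^{\mathbb{Z}}$ (product topology) be the set of bi-infinite sequences all of whose finite subwords lie in $\mathcal{L}$. The shift is $(\sigma(\tau))(k)=\tau(k+1)$. The subshift is minimal if every $\sigma$-orbit is dense in $\Sigma$. For $\tau\in\Sigma$, $\mathcal{S}(\tau)=\cdots\mathcal{S}(\tau(-1))\mathcal{S}(\tau(0))\mathcal{S}(\tau(1))\cdots$ with $\mathcal{S}(\tau(0))$ starting at coordinate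 $0$. $\mathcal{S}$ is recognizable if for every $\tau\in\Sigma$ there are a unique $\tau'\in\Sigma$ and $0\le k\le|\mathcal{S}(\tau'(0))|-1$ with $\tau=\sigma^k(\mathcal{S}(\tau'))$. Write $[\alpha]=\{\tau\in\Sigma:\tau(0)=\alpha\}$. The substitution matrix $M$ has entry $M_{\alpha\beta}$ equal to the number of occurrences of $\alpha$ in $\mathcal{S}(\beta)$; $\lambda$ is its Perron–Frobenius eigenvalue. **Measure.** $\mu$ is a $\sigma$-invariant Borel probability measure on $\Sigma$. Standing conventions: $\lambda>1$, $\mu([\alpha])>0$ for each $\alpha\in\mathcal{A}$, and $\mu(\mathcal{S}^n([\alpha]))=\mu([\alpha])/\lambda^n$ for all $\alpha\in\mathcal{A}$, $n\ge0$. **Addresses.** Let $\mathsf{A}=\{(\alpha,j):\alpha\in\mathcal{A},\ 0\le j\le|\mathcal{S}(\alpha)|-1\}$ and, for $\alpha\in\mathcal{A}$, $\mathsf{T}(\alpha)=\{(\beta,j)\in\mathsf{A}:\mathcal{S}(\beta)(j)=\alpha\}$. An address is a finite or infinite sequence $((\alpha_1,j_1),(\alpha_2,j_2),\dots)$ in $\mathsf{A}$ with $(\alpha_k,j_k)\in\mathsf{T}(\alpha_{k-1})$ for all $k>1$; $\mathbf{A}_n$ is the set of addresses of length $n$. For $\tau\in\Sigma$, recognizability gives a unique sequence $\tau^{(0)}=\tau,\tau^{(1)},\tau^{(2)},\dots$ in $\Sigma$ and integers $j_n$ with $\tau^{(n-1)}=\sigma^{j_n}(\mathcal{S}(\tau^{(n)}))$,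 $0\le j_n<|\mathcal{S}(\tau^{(n)}(0))|$; the address of $\tau$ is $\mathbf{a}(\tau)=((\alpha_n,j_n))_{n\ge1}$ with $\alpha_n=\tau^{(n)}(0)$. **Canonical isomorphism.** Choose $\Phi_0:\mathcal{A}\to[0,1)$ so that the intervals $[\Phi_0(\alpha),\Phi_0(\alpha)+\mu([\alpha]))$, $\alpha\in\mathcal{A}$, partition $[0,1)$. For each $\alpha\in\mathcal{A}$ choose an ordering of $\mathsf{T}(\alpha)$ and let $\phi:\mathsf{T}(\alpha)\to[0,\mu([\alpha]))$ give the left endpoints of the partition, in that order, of $[0,\mu([\alpha]))$ into intervals $[\phi(\beta,j),\phi(\beta,j)+\mu([\beta])/\lambda)$, $(\beta,j)\in\mathsf{T}(\alpha)$. (Since the sets $\mathsf{T}(\alpha)$ partition $\mathsf{A}$, this defines $\phi$ on $\mathsf{A}$. The orderings are recorded by a dual substitution $\mathcal{S}_*$, where $\mathcal{S}_*(\alpha)$ lists the letters $\beta$ of the elements $(\beta,j)\in\mathsf{T}(\alpha)$ in order; ''given by $\mathcal{S}_*$'' means given by these choices.) For $\mathbf{a}=((\alpha_1,j_1),\dots,(\alpha_n,j_n))\in\mathbf{A}_n$ put $$\Phi_n(\mathbf{a})=\Phi_0(\mathcal{S}(\alpha_1)(j_1))+\sum_{k=1}^n\frac{\phi(\alpha_k,j_k)}{\lambda^{k-1}},\qquad \mathbf{I}(\mathbf{a})=\Big[\Phi_n(\mathbf{a}),\Phi_n(\mathbf{a})+\frac{\mu([\alpha_n])}{\lambda^n}\Big).$$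 For each $n$ the intervals $\mathbf{I}(\mathbf{a})$, $\mathbf{a}\in\mathbf{A}_n$, partition $[0,1)$, and these partitions are successively refining. The canonical isomorphism is $\Phi(\tau)=\lim_{n\to\infty}\Phi_n(\mathbf{a}_n(\tau))$, where $\mathbf{a}_n(\tau)$ is the length-$n$ prefix of $\mathbf{a}(\tau)$. **The map $\mathfrak{F}$.** For an address $\mathbf{a}=((\alpha_k,j_k))_k$ let $\mathbf{n}(\mathbf{a})$ be the smallest $k$ with $j_k<|\mathcal{S}(\alpha_k)|-1$ ($\infty$ if there is none). If $\mathbf{n}(\mathbf{a})=N<\infty$, define $\mathcal{V}(\mathbf{a})$ by replacing $(\alpha_N,j_N)$ with $(\alpha_N,j_N+1)$, replacing the first $N-1$ entries by the unique address $((\beta_1,0),\dots,(\beta_{N-1},0))$ with $\beta_{N-1}=\mathcal{S}(\alpha_N)(j_N+1)$ and $\beta_{k-1}=\mathcal{S}(\beta_k)(0)$, and leaving all entries of index $>N$ unchanged. For $x\in[0,1)$ let $\mathbf{a}(x)$ be the infinite address whose length-$n$ prefix $\mathbf{a}_n(x)$ is, for each $n$, the unique element of $\mathbf{A}_n$ with $x\in\mathbf{I}(\mathbf{a}_n(x))$, and let $\mathbf{n}(x)=\mathbf{n}(\mathbf{a}(x))$. For $x$ with $\mathbf{n}(x)=N<\infty$ the infinite interval exchange transformation is $$\mathfrak{F}(x)=x-\Phi_N(\mathbf{a}_N(x))+\Phi_N(\mathcal{V}(\mathbf{a}_N(x))).$$ *)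

(* Defs.v *)
From HB Require Import structures.
From mathcomp Require Import all_boot all_order all_algebra complex.
From mathcomp Require Import all_classical all_reals all_analysis.
Import Order.TTheory GRing.Theory Num.Theory.
Import numFieldNormedType.Exports.

Set Implicit Arguments.
Unset Strict Implicit.
Unset Printing Implicit Defensive.

Local Open Scope classical_set_scope.
Local Open Scope ring_scope.

(* A nonempty finite alphabet.  The base point only serves to make the space
   of sequences pointed, as measurable types have to be. *)
#[short(type="alphabetType")]
HB.structure Definition Alphabet := {A of Finite A & Pointed A}.

Definition biseq (A : Type) : Type := int -> A.

HB.instance Definition _ (A : alphabetType) := Pointed.on (biseq A).
HB.instance Definition _ (A : alphabetType) :=
  Topological.copy (biseq A) (prod_topology (fun _ : int => discrete_topology A)).

Notation borel_biseq A := (g_sigma_algebraType (@open (biseq A))).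

Section Substitutions.
Variables (A : alphabetType) (S : A -> seq A).
Implicit Types (tau : biseq A) (w : seq A) (a : A) (p : A * nat).

Definition is_substitution := forall a, S a != [::].

Definition subst_word w : seq A := flatten [seq S a | a <- w].

Definition language : set (seq A) :=
  [set w | exists n a, infix w (iter n subst_word [:: a])].

Definition subshift : set (biseq A) :=
  [set tau | forall (k : int) (m : nat),
     language (mkseq (fun i => tau (k + i%:Z)) m)].

Definition shift_by (k : int) tau : biseq A := fun i => tau (i + k).

Definition shift_map tau : biseq A := shift_by 1 tau.

(* Every orbit under the invertible map [shift] is dense in the subshift. *)
Definition minimal_subshift :=
  forall tau, subshift tau ->
    subshift `<=` closure (range (fun k : int => shift_by k tau)).

(* [Negz n] is the integer - n - 1.  A nonnegative coordinate n is read off the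
   word S(tau 0) ... S(tau n), and the coordinate - n - 1 off the word
   S(tau (- n - 1)) ... S(tau (- 1)), from right to left; these words are long
   enough as S is nonerasing. *)
Definition subst_biseq tau : biseq A := fun i =>
  match i with
  | Posz n => nth (tau 0) (subst_word (mkseq (fun k => tau (Posz k)) n.+1)) n
  | Negz n =>
    nth (tau 0) (rev (subst_word (rev (mkseq (fun k => tau (Negz k)) n.+1)))) n
  end.

Definition desubstitution tau (q : biseq A * nat) : Prop :=
  [/\ subshift q.1, (q.2 < size (S (q.1 0)))%N
    & tau = shift_by q.2%:Z (subst_biseq q.1)].

Definition recognizable :=
  forall tau, subshift tau -> exists! q, desubstitution tau q.

Definition cylinder a : set (biseq A) := [set tau | subshift tau /\ tau 0 = a].

Definition subst_matrix (R : realType) : 'M[R]_#|A| :=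
  \matrix_(i, j) (count_mem (enum_val i) (S (enum_val j)))%:R.

(* S(a)(j) for p = (a, j); it is only relevant when j < |S(a)|. *)
Definition letter p : A := nth p.1 (S p.1) p.2.

Definition is_digit p : bool := (p.2 < size (S p.1))%N.

Definition incoming a p : bool := is_digit p && (letter p == a).

Definition is_address (s : seq (A * nat)) : bool :=
  all is_digit s && sorted (fun p q => incoming p.1 q) s.

Definition desubst tau : biseq A * nat := xget (tau, 0%N) (desubstitution tau).

Definition ancestor (n : nat) tau : biseq A :=
  iter n (fun t => (desubst t).1) tau.

(* Infinite addresses are indexed from 0: the value at n is the entry of
   index n + 1. *)
Definition address_of tau : nat -> A * nat :=
  fun n => (ancestor n.+1 tau 0, (desubst (ancestor n tau)).2).

(* The dual substitution is given with the pairs (b, j) it comes from, since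
   the word of letters b alone does not determine the ordering. *)
Record dual_substitution := DualSubstitution {
  dual_order : A -> seq (A * nat);
  dual_order_uniq : forall a, uniq (dual_order a);
  mem_dual_order : forall a p, (p \in dual_order a) = incoming a p }.

Definition dual_word (D : dual_substitution) a : seq A :=
  [seq p.1 | p <- dual_order D a].

Definition not_last p : bool := (p.2 < (size (S p.1)).-1)%N.

(* The number n(s), counted from 1; None stands for infinity. *)
Definition first_not_last (s : nat -> A * nat) : option nat :=
  if pselect (exists k, not_last (s k)) is left h then Some (ex_minn h).+1
  else None.

(* The word (b_1, 0) ... (b_n, 0) with b_n = a and b_(k-1) = S(b_k)(0). *)
Definition zero_address (n : nat) a : seq (A * nat) :=
  rev [seq (b, 0%N) | b <- traject (fun b => letter (b, 0%N)) a n].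

Definition vershik (s : seq (A * nat)) : seq (A * nat) :=
  let m := find not_last s in
  if drop m s is p :: s' then
    let q := (p.1, p.2.+1) in zero_address m (letter q) ++ q :: s'
  else s.

End Substitutions.

Coercion dual_word : dual_substitution >-> Funclass.

(* The Perron-Frobenius eigenvalue of a nonnegative matrix: an eigenvalue that
   is also its spectral radius. *)
Definition perron_frobenius_eigenvalue (R : realType) (n : nat) (M : 'M[R]_n)
    (lambda : R) : Prop :=
  eigenvalue M lambda /\
  forall z : R[i], eigenvalue (map_mx (real_complex R) M) z ->
    `|z| <= real_complex R lambda.

(* A measure on the subshift is encoded as a measure mu on the space of all
   sequences, to be used with the hypothesis mu (subshift S) = 1. *)
Section CanonicalIsomorphism.
Variables (R : realType) (A : alphabetType) (S : A -> seq A).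
Variables (mu : probability (borel_biseq A) R) (lambda : R).
Variables (Phi0 : A -> R) (D : dual_substitution S).

Definition shift_invariant :=
  forall B : set (borel_biseq A), measurable B -> mu (@shift_map A @^-1` B) = mu B.

Definition letter_measure (a : A) : R := fine (mu (cylinder S a)).

Definition left_endpoint (p : A * nat) : R :=
  let s := dual_order D (letter S p) in
  \sum_(q <- take (index p s) s) letter_measure q.1 / lambda.

(* The exponent is k, and not k - 1, since entries are indexed from 0. *)
Definition Phi_address (s : seq (A * nat)) : R :=
  if s is p :: _ then
    Phi0 (letter S p) +
    \sum_(0 <= k < size s) left_endpoint (nth p s k) / lambda ^+ k
  else 0.

Definition address_interval (s : seq (A * nat)) : set R :=
  if s is p :: s' then
    `[Phi_address s,
      Phi_address s + letter_measure (last p s').1 / lambda ^+ size s[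
  else set0.

Definition canonical_iso (tau : biseq A) : R :=
  lim ((fun n => Phi_address (mkseq (address_of S tau) n)) @ \oo).

Definition point_address (x : R) (s : nat -> A * nat) : Prop :=
  forall n, is_address S (mkseq s n.+1) /\ address_interval (mkseq s n.+1) x.

Definition address_at (x : R) : option (nat -> A * nat) :=
  xget None (Some @` point_address x).

(* The interval exchange as a partial map: None where it is not defined. *)
Definition interval_exchange (x : R) : option R :=
  obind (fun s : nat -> A * nat =>
    omap (fun N : nat => let t := mkseq s N in
      x - Phi_address t + Phi_address (vershik S t)) (first_not_last S s))
  (address_at x).

End CanonicalIsomorphism.

(* X0 and Y0 are the phase spaces, carried by the ambient types X and Y. *)
Definition measurable_conjugacy d d' (R : realType)
    (X : measurableType d) (Y : measurableType d')
    (mu : {measure set X -> \bar R}) (nu : {measure set Y -> \bar R})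
    (X0 : set X) (Y0 : set Y) (T : X -> X) (F : Y -> option Y) (f : X -> Y) :=
  [/\ set_fun X0 Y0 f,
      measurable_fun X0 f /\
      (forall B, measurable B -> mu (X0 `&` f @^-1` B) = nu (Y0 `&` B)),
      (exists X1 Y1,
        [/\ measurable X1 /\ measurable Y1,
            X1 `<=` X0 /\ Y1 `<=` Y0,
            mu (X0 `\` X1) = 0%E /\ nu (Y0 `\` Y1) = 0%E
          & set_bij X1 Y1 f])
    & {ae mu, forall x, X0 x -> F (f x) = Some (f (T x))}].

(* Main.v *)
Require Import Defs.
From HB Require Import structures.
From mathcomp Require Import all_boot all_order all_algebra complex zify lra.
From mathcomp Require Import all_classical all_reals all_analysis.
From mathcomp Require measurable_realfun.
Import Order.TTheory GRing.Theory Num.Theory.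
Import numFieldNormedType.Exports.

(** The subshift with mu and the interval [0,1) with Lebesgue measure carry the
same kind of coordinates: a sequence tau has its address, obtained by
desubstituting repeatedly, and a point x has the address of the nested
intervals that contain it.  For an address s of length n that ends with the
letter a, the set of sequences whose address starts with s and the interval of
s both have measure mu[a] / lambda^n, so that the two families of addresses
have the same law.  All measure theory below is done once for such a coding
([coding]) and then read on both sides.

The measure of the set of sequences is [mu_cell]: this set is the image of the
cylinder [a] under n substitutions interlaced with shifts, which commute into
one shift of S^n ([rebuild_shift]); that image is closed, as a continuous image
of a compact set, and its measure is given by the scaling hypothesis and the
invariance of mu.  Taking n = 1 shows that the intervals attached to T(a) fill
[0, mu[a]) exactly ([letter_measure_split]); this is what makes the intervals
of the addresses of length n a partition of [0,1) ([interval_cover],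
[interval_inj]) that refines the one of length n - 1 ([interval_prefix]).

The canonical isomorphism is the value of the address, the limit of the left
endpoints of its intervals ([limPhi]).  On [0,1) the value of the address of x
is x.  Left endpoints increase to the value, so the law of the value is the
limit of the laws of functions of finitely many digits, which agree on both
sides; therefore the isomorphism preserves measure ([iso_preserves]).

An address determines its sequence unless its digits are eventually all first,
or eventually all last, in their words: otherwise the known window grows in
both directions ([address_of_inj]).  The exceptional addresses are negligible,
because the last letter and the digits of an address of length n determine it,
so that a prescribed sequence of digits has measure at most a constant over
lambda^n ([follows_null]).  The only other obstruction is that the value of an
address may be the right endpoint of one of its intervals; right endpoints are
countably many, hence negligible by preservation of measure.  Outside these
sets the isomorphism is injective, and it is surjective because every address
is realised, by compactness ([address_realized]).

Finally, the shift acts on addresses as the Vershik map ([address_of_shift]):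
if the first digit is not last it is increased, and otherwise it becomes first
and the shift is passed on to the desubstituted sequence.  The digits after the
first one that is not last are unchanged, so they contribute the same amount to
both values ([limPhi_tail]), and the values differ by the translation that
defines the interval exchange. *)

Set Implicit Arguments.
Unset Strict Implicit.
Unset Printing Implicit Defensive.

Local Open Scope classical_set_scope.
Local Open Scope ring_scope.

(** * Words and substituted sequences *)

Lemma mkseq_cons (T : Type) (f : nat -> T) n :
  mkseq f n.+1 = f 0%N :: mkseq (fun k => f k.+1) n.
Proof.
by rewrite /mkseq -[iota 0 n.+1]/(0%N :: iota (1 + 0) n) iotaDl /= -map_comp.
Qed.

Section Words.
Variables (A : alphabetType) (S : A -> seq A).
Hypothesis hS : is_substitution S.
Implicit Types (z : biseq A) (w : seq A) (a : A).

Lemma subst_word1 a : subst_word S [:: a] = S a.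
Proof. by rewrite /subst_word /= cats0. Qed.

Lemma subst_word_cat w1 w2 :
  subst_word S (w1 ++ w2) = subst_word S w1 ++ subst_word S w2.
Proof. by rewrite /subst_word map_cat flatten_cat. Qed.

Lemma size_subst_gt0 a : (0 < size (S a))%N.
Proof. by rewrite lt0n size_eq0 hS. Qed.

Lemma size_subst_word w : (size w <= size (subst_word S w))%N.
Proof.
elim: w => //= a w IH; rewrite /subst_word /= size_cat.
by have := size_subst_gt0 a; rewrite /subst_word in IH; lia.
Qed.

(** Of two prefixes of one sequence, the shorter is a prefix of the longer, and
    so are their images. *)
Lemma nth_subst_word_mkseq d (f : nat -> A) m m' n :
  (n < size (subst_word S (mkseq f m)))%N ->
  (n < size (subst_word S (mkseq f m')))%N ->
  nth d (subst_word S (mkseq f m)) n = nth d (subst_word S (mkseq f m')) n.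
Proof.
wlog: m m' / (m <= m')%N.
  by move=> W; case/orP: (leq_total m m') => h h1 h2; [|apply/esym]; exact: W.
move=> le_mm'; have -> : mkseq f m' = mkseq f m ++ map f (iota m (m' - m)).
  by rewrite /mkseq -map_cat -(iotaD 0) subnKC.
by rewrite subst_word_cat => h _; rewrite nth_cat h.
Qed.

End Words.

Section SubstBiseq.
Variables (A : alphabetType) (S : A -> seq A).
Hypothesis hS : is_substitution S.
Implicit Types (z : biseq A) (w : seq A) (a : A).

(** The left half of a substituted sequence, read from right to left, is the
    image of the reversed left half under the substitution with reversed words;
    both halves are thereby instances of the same computation. *)
Lemma rev_subst_word w :
  rev (subst_word S (rev w)) = subst_word (fun a => rev (S a)) w.
Proof.
elim: w => //= a w IH.
by rewrite rev_cons -cats1 subst_word_cat rev_cat IH subst_word1.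
Qed.

Lemma rev_nonerasing : is_substitution (fun a => rev (S a)).
Proof. by move=> a; rewrite -size_eq0 size_rev size_eq0. Qed.

(** The definition of [subst_biseq] reads the coordinate n off the image of
    n + 1 letters; any prefix with a long enough image gives the same letter. *)
Lemma subst_biseq_nneg d z m n :
  (n < size (subst_word S (mkseq (fun k => z (Posz k)) m)))%N ->
  subst_biseq S z (Posz n) =
  nth d (subst_word S (mkseq (fun k => z (Posz k)) m)) n.
Proof.
move=> h; rewrite (set_nth_default (z 0) d h) /=.
apply: nth_subst_word_mkseq => //.
by apply: leq_trans (size_subst_word hS _); rewrite size_mkseq.
Qed.

Lemma subst_biseq_neg d z m n :
  (n < size (subst_word (fun a => rev (S a))
              (mkseq (fun k => z (Negz k)) m)))%N ->
  subst_biseq S z (Negz n) =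
  nth d (subst_word (fun a => rev (S a)) (mkseq (fun k => z (Negz k)) m)) n.
Proof.
move=> h; rewrite (set_nth_default (z 0) d h) /= rev_subst_word.
apply: nth_subst_word_mkseq => //.
by apply: leq_trans (size_subst_word rev_nonerasing _); rewrite size_mkseq.
Qed.

(** The word S(z 0) moves from the right of the origin to the left of it. *)
Lemma subst_biseq_shift1 z :
  subst_biseq S (shift_by 1 z) =
  shift_by (Posz (size (S (z 0)))) (subst_biseq S z).
Proof.
have L0 := size_subst_gt0 hS (z 0).
have S1 f n : (n < size (subst_word S (mkseq f n.+1)))%N.
  by apply: leq_trans (size_subst_word hS _); rewrite size_mkseq.
have S2 f n : (n < size (subst_word (fun a => rev (S a)) (mkseq f n.+1)))%N.
  by apply: leq_trans (size_subst_word rev_nonerasing _); rewrite size_mkseq.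
have consE (T : A -> seq A) (f : nat -> A) n : subst_word T (mkseq f n.+1) =
    T (f 0%N) ++ subst_word T (mkseq (fun k => f k.+1) n).
  by rewrite mkseq_cons.
apply/funext => -[n|n]; rewrite /(shift_by (Posz (size _))).
- have E : (fun k => shift_by 1 z (Posz k)) = (fun k => z (Posz k.+1)).
    by apply/funext => k; rewrite /shift_by; congr z; lia.
  rewrite (subst_biseq_nneg (z 0) (m := n.+1)) ?S1 // E.
  have -> : (Posz n + Posz (size (S (z 0))))%R = Posz (size (S (z 0)) + n).
    by lia.
  have E' := consE S (fun k => z (Posz k)) n.+1.
  rewrite (subst_biseq_nneg (z 0) (m := n.+2)) E'; last first.
    by rewrite size_cat ltn_add2l S1.
  by rewrite nth_cat ltnNge leq_addr /= addKn.
- have E : mkseq (fun k => shift_by 1 z (Negz k)) n.+2 =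
       z 0 :: mkseq (fun k => z (Negz k)) n.+1.
    by rewrite mkseq_cons; congr (_ :: _); apply: eq_mkseq => k;
      rewrite /shift_by; congr z; lia.
  have nL : (n < size (subst_word (fun a => rev (S a))
      (mkseq (fun k => shift_by 1 z (Negz k)) n.+2)))%N.
    by apply: ltn_trans (S2 _ _).
  rewrite (subst_biseq_neg (z 0) nL) E.
  rewrite -[z 0 :: _]cat1s subst_word_cat subst_word1 nth_cat size_rev.
  case: ltnP => h.
    rewrite nth_rev //.
    have -> : (Negz n + Posz (size (S (z 0))))%R = Posz (size (S (z 0)) - n.+1).
      by lia.
    rewrite (subst_biseq_nneg (z 0) (m := 1)) mkseq_cons subst_word1 //.
    by rewrite ltn_subrL /=; exact: L0.
  have -> : (Negz n + Posz (size (S (z 0))))%R = Negz (n - size (S (z 0))).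
    by lia.
  apply/esym/subst_biseq_neg; apply: leq_ltn_trans (S2 _ _).
  by rewrite leq_subr.
Qed.

Lemma shift_by0 z : shift_by 0 z = z.
Proof. by apply/funext => i; rewrite /shift_by addr0. Qed.

Lemma shift_byD i j z : shift_by i (shift_by j z) = shift_by (i + j) z.
Proof. by apply/funext => k; rewrite /shift_by addrA. Qed.

(** The basic commutation rule: a shift by j letters before the substitution
    becomes a shift by the length of the image of these letters. *)
Lemma subst_biseq_shift z j : subst_biseq S (shift_by (Posz j) z) =
  shift_by (Posz (size (subst_word S (mkseq (fun k => z (Posz k)) j))))
    (subst_biseq S z).
Proof.
elim: j => [|j IH]; first by rewrite /subst_word /= !shift_by0.
have -> : shift_by (Posz j.+1) z = shift_by 1 (shift_by (Posz j) z).
  by rewrite shift_byD; congr (shift_by _ _); lia.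
rewrite subst_biseq_shift1 IH shift_byD.
apply: (congr1 (fun i => shift_by i _)).
rewrite mkseqS -cats1 subst_word_cat size_cat subst_word1.
by rewrite /shift_by add0r; lia.
Qed.

Lemma subst_biseq_prefix z m :
  let w := mkseq (fun k => z (Posz k)) m in
  mkseq (fun k => subst_biseq S z (Posz k)) (size (subst_word S w)) =
  subst_word S w.
Proof.
move=> w; apply: (@eq_from_nth _ (z 0)); rewrite ?size_mkseq // => i Hi.
by rewrite nth_mkseq // (subst_biseq_nneg (z 0) Hi).
Qed.

Lemma iter_subst_biseq_shift n z j :
  iter n (subst_biseq S) (shift_by (Posz j) z) =
  shift_by (Posz (size (iter n (subst_word S) (mkseq (fun k => z (Posz k)) j))))
    (iter n (subst_biseq S) z).
Proof.
elim: n z j => [|n IH] z j; first by rewrite /= size_mkseq.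
by rewrite !iterSr subst_biseq_shift IH subst_biseq_prefix -!iterSr.
Qed.

Lemma subst_biseq_letter z j : (j < size (S (z 0%R)))%N ->
  subst_biseq S z (Posz j) = nth (z 0) (S (z 0)) j.
Proof.
by move=> h; rewrite (subst_biseq_nneg (z 0) (m := 1)) mkseq_cons subst_word1.
Qed.

Definition agree (l r : nat) (x y : biseq A) :=
  (forall k, (k < r)%N -> x (Posz k) = y (Posz k)) /\
  (forall k, (k < l)%N -> x (Negz k) = y (Negz k)).

(** Windows grow under desubstitution: as the words of S are nonempty, the
    image of a common window is at least as long on the left, and on the right
    it gains the whole word over the origin.  A shift by j then transfers j
    coordinates to the left. *)
Lemma subst_agree l r j x y : agree l r.+1 x y -> (j < size (S (x 0%R)))%N ->
  agree (l + j) (r + (size (S (x 0%R)) - j))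
    (shift_by (Posz j) (subst_biseq S x)) (shift_by (Posz j) (subst_biseq S y)).
Proof.
move=> [Hr Hl] Hj.
have Er m : (m <= r.+1)%N ->
    mkseq (fun k => x (Posz k)) m = mkseq (fun k => y (Posz k)) m.
  move=> h; apply/eq_in_map => k; rewrite mem_iota => /andP[_ hk].
  by apply: Hr; lia.
have El m : (m <= l)%N ->
    mkseq (fun k => x (Negz k)) m = mkseq (fun k => y (Negz k)) m.
  move=> h; apply/eq_in_map => k; rewrite mem_iota => /andP[_ hk].
  by apply: Hl; lia.
have P n : (n < r + size (S (x 0%R)))%N ->
    subst_biseq S x (Posz n) = subst_biseq S y (Posz n).
  move=> hn; have hs : (n < size (subst_word S
      (mkseq (fun k => x (Posz k)) r.+1)))%N.
    apply: leq_trans hn _; rewrite /subst_word /= size_cat addnC leq_add2l.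
    by apply: leq_trans (size_subst_word hS _); rewrite size_map size_iota.
  by rewrite (subst_biseq_nneg (x 0) hs) Er // -subst_biseq_nneg // -Er.
have N n : (n < l)%N -> subst_biseq S x (Negz n) = subst_biseq S y (Negz n).
  move=> hn; have hs : (n < size (subst_word (fun a => rev (S a))
      (mkseq (fun k => x (Negz k)) l)))%N.
    apply: leq_trans hn _.
    by apply: leq_trans (size_subst_word rev_nonerasing _); rewrite size_mkseq.
  by rewrite (subst_biseq_neg (x 0) hs) El // -subst_biseq_neg // -El.
split=> k hk; rewrite /shift_by.
  by rewrite -PoszD; apply: P; lia.
have [h|h] := ltnP k j.
  have -> : (Negz k + Posz j)%R = Posz (j - k.+1) by lia.
  by apply: P; lia.
have -> : (Negz k + Posz j)%R = Negz (k - j) by lia.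
by apply: N; lia.
Qed.

Lemma subshift_shift k z : subshift S z -> subshift S (shift_by k z).
Proof.
move=> h i m; have := h (i + k) m; congr (language S _).
by apply: eq_map => j; rewrite /shift_by; congr z; lia.
Qed.

Lemma language_subst w w' : language S w -> infix w' (subst_word S w) ->
  language S w'.
Proof.
move=> [n [a /infixP[p [s E]]]] h; exists n.+1, a.
rewrite iterS E !subst_word_cat.
exact/infix_catl/infix_catr.
Qed.

Lemma infix_mkseq (T : eqType) (f : nat -> T) k m N : (k + m <= N)%N ->
  infix (mkseq (fun i => f (k + i)%N) m) (mkseq f N).
Proof.
move=> h; have -> : mkseq f N = mkseq f k ++ mkseq (fun i => f (k + i)%N) m ++
    map f (iota (k + m) (N - (k + m))).
  have E : mkseq (fun i => f (k + i)%N) m = map f (iota k m).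
    by rewrite -{2}(addn0 k) iotaDl -map_comp.
  rewrite E /mkseq -!map_cat -(iotaD k) -{1}(add0n k) -iotaD; congr map.
  by congr iota; lia.
exact/infixP/ex_intro/ex_intro.
Qed.

(** A window of S(z) may start at a negative coordinate k.  Recentring z at
    -|k| moves it to the nonnegative side, where it is a factor of the image of
    a prefix of the recentred sequence. *)
Lemma subshift_subst z : subshift S z -> subshift S (subst_biseq S z).
Proof.
move=> hz k m; pose j := absz k; pose z' := shift_by (- Posz j) z.
have hz' : subshift S z' by exact: subshift_shift.
have zE : z = shift_by (Posz j) z'.
  by rewrite /z' shift_byD subrr shift_by0.
rewrite zE subst_biseq_shift; set L := size _.
have jL : (j <= L)%N.
  by rewrite (leq_trans _ (size_subst_word hS _)) ?size_mkseq.
pose n := absz (k + Posz L).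
have nE : k + Posz L = Posz n by rewrite /n /j in jL *; lia.
have -> : mkseq (fun i => shift_by (Posz L) (subst_biseq S z') (k + Posz i)) m =
    mkseq (fun i => (fun q => subst_biseq S z' (Posz q)) (n + i)%N) m.
  by apply: eq_map => i; rewrite /shift_by; congr (subst_biseq S z'); lia.
have := hz' 0 (n + m)%N.
have -> : mkseq (fun i => z' (0 + Posz i)) (n + m) =
          mkseq (fun i => z' (Posz i)) (n + m).
  by apply: eq_map => i; rewrite add0r.
move/language_subst; apply; rewrite -subst_biseq_prefix.
apply: infix_mkseq.
by rewrite (leq_trans _ (size_subst_word hS _)) ?size_mkseq.
Qed.

End SubstBiseq.

(** * Addresses of sequences *)

Section Addresses.
Variables (A : alphabetType) (S : A -> seq A).
Hypothesis hS : is_substitution S.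
Hypothesis hrec : recognizable S.
Implicit Types (tau x y z : biseq A) (s : seq (A * nat)) (a : A).

Lemma desubstP tau : subshift S tau -> desubstitution S tau (desubst S tau).
Proof. by move=> /hrec[q [hq _]]; exact: (xgetI _ hq). Qed.

Lemma desubstE tau x j : subshift S tau -> subshift S x ->
  (j < size (S (x 0%R)))%N -> tau = shift_by (Posz j) (subst_biseq S x) ->
  desubst S tau = (x, j).
Proof.
move=> ht hx hj E; have [q [_ uq]] := hrec ht.
by rewrite -(uq _ (desubstP ht)) -[RHS]uq.
Qed.

Lemma desubst_subshift tau : subshift S tau -> subshift S (desubst S tau).1.
Proof. by case/desubstP. Qed.

Lemma ancestor_subshift n tau : subshift S tau -> subshift S (ancestor S n tau).
Proof. by move=> h; elim: n => //= n; exact: desubst_subshift. Qed.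

Lemma address_of_0 tau :
  address_of S tau 0 = ((desubst S tau).1 0, (desubst S tau).2).
Proof. by []. Qed.

Lemma address_of_S tau n :
  address_of S tau n.+1 = address_of S (desubst S tau).1 n.
Proof. by rewrite /address_of /ancestor -!iterSr. Qed.

Lemma address_of_digit tau n : subshift S tau ->
  is_digit S (address_of S tau n).
Proof. by move=> /(ancestor_subshift n)/desubstP[]. Qed.

(** The first entry (b, j) of the address of tau says that tau 0 is the letter
    of rank j in S(b). *)
Lemma letter_address_of_0 tau : subshift S tau ->
  letter S (address_of S tau 0) = tau 0.
Proof.
move=> /desubstP[_ hj E].
by rewrite [in RHS]E /shift_by add0r subst_biseq_letter.
Qed.

Lemma letter_address_of_S tau n : subshift S tau ->
  letter S (address_of S tau n.+1) = (address_of S tau n).1.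
Proof.
move=> ht; have := letter_address_of_0 (ancestor_subshift n.+1 ht).
by rewrite /address_of /ancestor.
Qed.

Definition infinite_address (s : nat -> A * nat) :=
  forall n, is_digit S (s n) /\ letter S (s n.+1) = (s n).1.

Lemma address_of_infinite tau : subshift S tau ->
  infinite_address (address_of S tau).
Proof.
by move=> ht n; split; [exact: address_of_digit|exact: letter_address_of_S].
Qed.

Lemma is_address_cons p s : is_address S (p :: s) =
  [&& is_digit S p, (if s is q :: _ then letter S q == p.1 else true)
    & is_address S s].
Proof.
rewrite /is_address /=; case: s => [|q s]; rewrite ?andbT //= /incoming.
by case: (is_digit S p); case: (is_digit S q); case: (letter S q == p.1);
  rewrite /= ?andbF.
Qed.

(** The length-n prefixes of an infinite address are extended on the right,
    whereas [is_address] is checked from the left. *)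
Lemma is_address_rcons s p : is_address S (rcons s p) =
  [&& is_address S s, is_digit S p
    & (if s is q :: s' then letter S p == (last q s').1 else true)].
Proof.
elim: s => [|q s IH]; first by rewrite /= is_address_cons /is_address /= andbT.
rewrite rcons_cons !is_address_cons IH.
case: s {IH} => [|q' s] /=; first by rewrite /= andbT eq_sym; case: is_digit;
  case: is_digit; case: eqP.
by rewrite !andbA.
Qed.

Lemma is_address_mkseq (s : nat -> A * nat) n : infinite_address s ->
  is_address S (mkseq s n).
Proof.
move=> hs; elim: n => // n IH; rewrite mkseqS is_address_rcons IH (hs n).1 /=.
case: n {IH} => // n; rewrite mkseqS.
by case: (mkseq s n) => [|q t] /=; rewrite ?last_rcons (hs n).2.
Qed.

Lemma infinite_addressP (s : nat -> A * nat) :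
  (forall n, is_address S (mkseq s n.+1)) -> infinite_address s.
Proof.
move=> hs n; have := hs n.+1; rewrite mkseqS is_address_rcons mkseqS.
rewrite is_address_rcons => /and3P[/and3P[_ -> _] _ E]; split=> //.
by move: E; case: (mkseq s n) => [|q t] /=; rewrite ?last_rcons => /eqP.
Qed.

(** The sequence whose address starts with s and whose ancestor of order
    [size s] is y, when the letter of y at the origin is the last one of s. *)
Definition rebuild s y : biseq A :=
  foldr (fun p x => shift_by (Posz p.2) (subst_biseq S x)) y s.

Lemma rebuild_address_of n tau : subshift S tau ->
  rebuild (mkseq (address_of S tau) n) (ancestor S n tau) = tau.
Proof.
elim: n tau => // n IH tau ht; rewrite mkseq_cons.
have -> : ancestor S n.+1 tau = ancestor S n (desubst S tau).1.
  by rewrite /ancestor iterSr.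
have -> : (fun k => address_of S tau k.+1) = address_of S (desubst S tau).1.
  by apply/funext => k; rewrite address_of_S.
rewrite /= IH; last exact: desubst_subshift.
by have [_ _ <-] := desubstP ht.
Qed.

(** Recognizability: the digits used to rebuild a sequence are the ones found
    again by desubstituting it. *)
Lemma rebuildP s y : is_address S s -> subshift S y ->
  (if s is p :: s' then y 0 = (last p s').1 else True) ->
  [/\ subshift S (rebuild s y),
      (if s is p :: _ then rebuild s y 0 = letter S p else True) &
      mkseq (address_of S (rebuild s y)) (size s) = s].
Proof.
elim: s => [|p s IH] // hps hy hl.
move: hps; rewrite is_address_cons => /and3P[hp hps hs].
have [h1 h2 h3] : [/\ subshift S (rebuild s y), rebuild s y 0 = p.1 &
      mkseq (address_of S (rebuild s y)) (size s) = s].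
  case: s IH hps hs hl => [|q s] IH hps hs hl; first by [].
  by have [k1 k2 k3] := IH hs hy hl; split => //; rewrite k2; exact/eqP.
have hps' : subshift S (rebuild (p :: s) y).
  exact/subshift_shift/subshift_subst.
have hj : (p.2 < size (S (rebuild s y 0%R)))%N by rewrite h2.
have E : desubst S (rebuild (p :: s) y) = (rebuild s y, p.2).
  by apply: desubstE.
have E0 : address_of S (rebuild (p :: s) y) 0 = p.
  by rewrite address_of_0 E /= h2; case: (p).
split=> //; first by rewrite -letter_address_of_0 // E0.
rewrite [size _]/= mkseq_cons E0; congr cons.
by rewrite -[RHS]h3; apply: eq_mkseq => k; rewrite address_of_S E.
Qed.

Definition cell s : set (biseq A) :=
  [set tau | subshift S tau /\ mkseq (address_of S tau) (size s) = s].

Lemma cell_rebuild p s : is_address S (p :: s) ->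
  cell (p :: s) = rebuild (p :: s) @` cylinder S (last p s).1.
Proof.
move=> hps; apply/seteqP; split=> [tau [ht E]|_ [y [hy y0] <-]]; last first.
  by have [h1 _ h2] := rebuildP hps hy y0.
exists (ancestor S (size (p :: s)) tau); last first.
  by rewrite -{1}E rebuild_address_of.
split; first exact: ancestor_subshift.
have <- // : address_of S tau (size s) = last p s.
rewrite -[RHS]/(last p (p :: s)) -E -[size (p :: s)]/(size s).+1.
by rewrite mkseqS last_rcons.
Qed.

Lemma cell_nonaddress s : ~~ is_address S s -> cell s = set0.
Proof.
move=> hs; apply/seteqP; split=> // tau [ht E]; move: hs.
by rewrite -E is_address_mkseq //; exact: address_of_infinite.
Qed.

(** Every shift occurring in [rebuild s] acts on a sequence whose letter at the
    origin is prescribed by s, so its length after further substitutions does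
    not depend on y; hence h is the same for the whole cylinder. *)
Lemma rebuild_shift s a : is_address S s ->
  (if s is p :: s' then (last p s').1 = a else True) ->
  exists h : nat, forall y, y 0 = a ->
    rebuild s y = shift_by (Posz h) (iter (size s) (subst_biseq S) y).
Proof.
elim/last_ind: s a => [|s p IH] a.
  by move=> _ _; exists 0%N => y _; rewrite shift_by0.
rewrite is_address_rcons => /and3P[hs hp hl] hpa.
have pa : p.1 = a.
  by move: hpa; case: (s) => [|q s'] /=; rewrite ?last_rcons.
have [|h hh] := IH (letter S p) hs; first by case: (s) hl => // q s' /eqP.
exists (h + size (iter (size s) (subst_word S) (take p.2 (S a))))%N => y y0.
rewrite /rebuild -cats1 foldr_cat /= -/(rebuild s _) hh; last first.
  by rewrite /shift_by add0r subst_biseq_letter ?y0 -?pa.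
rewrite iter_subst_biseq_shift // shift_byD -PoszD size_cat addn1 iterSr.
apply: (congr1 (fun w =>
  shift_by (Posz (h + size (iter (size s) (subst_word S) w))%N) _)).
have hp' : (p.2 < size (S a))%N by rewrite -pa.
apply: (@eq_from_nth _ a).
  by rewrite size_mkseq size_takel // ltnW.
rewrite size_mkseq => i hi.
rewrite nth_mkseq // nth_take //.
have hiy : (i < size (S (y 0%R)))%N by rewrite y0; exact: ltn_trans hp'.
by rewrite subst_biseq_letter // (set_nth_default a) // y0.
Qed.

(** Each digit j of rank k contributes j known coordinates on the left and
    |S(a)| - 1 - j on the right. *)
Lemma agree_of_address n x y : subshift S x -> subshift S y ->
  (forall k, address_of S x k = address_of S y k) ->
  agree (\sum_(k < n) (address_of S x k).2)%N
        (\sum_(k < n) ((size (S (address_of S x k).1)).-1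
                        - (address_of S x k).2)).+1%N x y.
Proof.
elim: n x y => [|n IH] x y hx hy E.
  rewrite !big_ord0; split=> // -[|//] _.
  have -> : x (Posz 0) = x 0 by []. have -> : y (Posz 0) = y 0 by [].
  by rewrite -!letter_address_of_0 // E.
have split1 (f : A * nat -> nat) : (\sum_(k < n.+1) f (address_of S x k))%N =
    (f (address_of S x 0) + \sum_(k < n) f (address_of S (desubst S x).1 k))%N.
  by rewrite big_ord_recl; congr addn; apply: eq_bigr => k _;
    rewrite lift0 address_of_S.
rewrite (split1 snd) (split1 (fun p => (size (S p.1)).-1 - p.2)%N).
have [hx1 hjx Ex] := desubstP hx; have [hy1 hjy Ey] := desubstP hy.
have E1 k : address_of S (desubst S x).1 k = address_of S (desubst S y).1 k.
  by rewrite -!address_of_S.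
have := subst_agree hS (IH _ _ hx1 hy1 E1) hjx.
have [_ Ej] : (desubst S x).1 0 = (desubst S y).1 0 /\
    (desubst S x).2 = (desubst S y).2.
  by have := E 0%N; rewrite !address_of_0 => -[].
rewrite -Ex {3}Ej -Ey address_of_0 /=.
set l := (\sum_(i < n) _)%N; set r := (\sum_(i < n) _)%N.
have -> : ((size (S ((desubst S x).1 0%R))).-1 - (desubst S x).2 + r).+1 =
    (r + (size (S ((desubst S x).1 0%R)) - (desubst S x).2))%N.
  (* [Posz 0] and the zero of [int] are convertible but distinct for lia *)
  have hj : ((desubst S x).2 < size (S ((desubst S x).1 0%R)))%N := hjx.
  by lia.
by rewrite addnC.
Qed.

Lemma sum_unbounded (f : nat -> nat) :
  (forall K, exists k, (K <= k)%N /\ (0 < f k)%N) ->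
  forall M, exists n, (M <= \sum_(k < n) f k)%N.
Proof.
move=> hf; elim=> [|M [n hn]]; first by exists 0%N.
have [k [nk fk]] := hf n; exists k.+1.
rewrite big_ord_recr /= -[M.+1]addn1; apply: leq_add fk; apply: leq_trans hn _.
rewrite -!(big_mkord xpredT f) (@big_cat_nat _ _ _ n 0 k) //=.
by rewrite leq_addr.
Qed.

(** The addresses that determine a sequence on both sides of the origin: the
    digits are neither eventually first nor eventually last in their words. *)
Definition two_sided (s : nat -> A * nat) :=
  (forall K, exists k, (K <= k)%N /\ (0 < (s k).2)%N) /\
  (forall K, exists k, (K <= k)%N /\ not_last S (s k)).

Lemma address_of_inj x y : subshift S x -> subshift S y ->
  address_of S x = address_of S y -> two_sided (address_of S x) -> x = y.
Proof.
move=> hx hy E [hl hr].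
have E' k : address_of S x k = address_of S y k by rewrite E.
apply/funext => -[m|m].
- have [|n hn] := @sum_unbounded (fun k => (size (S (address_of S x k).1)).-1
      - (address_of S x k).2)%N _ m.
    move=> K; have [k [Kk hk]] := hr K; exists k; split=> //.
    by rewrite subn_gt0.
  by have [h _] := agree_of_address n hx hy E'; exact: h.
- have [n hn] := @sum_unbounded (fun k => (address_of S x k).2) hl m.+1.
  by have [_ h] := agree_of_address n hx hy E'; exact: h.
Qed.

(** A digit that is the last in its word is reset to 0, and its letter is then
    forced by the entry that follows it. *)
Lemma vershik_cons p s : ~~ not_last S p -> has (not_last S) s ->
  vershik S (p :: s) =
  (letter S (head p (vershik S s)), 0%N) :: vershik S s.
Proof.
move=> hp; rewrite has_find => hf.
rewrite /vershik [find _ (p :: s)]/= (negbTE hp).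
rewrite -[drop _.+1 (p :: s)]/(drop (find (not_last S) s) s) (drop_nth p hf).
set q := nth _ _ _; set m := find _ _; rewrite /zero_address.
rewrite trajectSr map_rcons rev_rcons /=; congr (_ :: _); congr (_, _).
by case: (m) => [|k] //; rewrite trajectSr map_rcons rev_rcons.
Qed.

(** Write tau = shift by j of S(tau1).  If j is not last in its word, the shift
    of tau comes from the same tau1 with the digit j + 1.  Otherwise it is
    S(tau1) moved by the whole word over the origin, which is the image of the
    shift of tau1, with digit 0; the induction continues with tau1. *)
Lemma address_of_shift m tau : subshift S tau ->
  (forall k, (k < m)%N -> ~~ not_last S (address_of S tau k)) ->
  not_last S (address_of S tau m) ->
  mkseq (address_of S (shift_map tau)) m.+1 =
    vershik S (mkseq (address_of S tau) m.+1) /\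
  forall k, (m < k)%N -> address_of S (shift_map tau) k = address_of S tau k.
Proof.
elim: m tau => [|m IH] tau ht hlt hm.
  have [h1 hj Et] := desubstP ht.
  have E : desubst S (shift_map tau) =
      ((desubst S tau).1, (desubst S tau).2.+1).
    apply: desubstE => //; first exact: subshift_shift.
      by move: hm; rewrite /not_last address_of_0 /=; lia.
    rewrite {1}Et /shift_map shift_byD.
    by apply: (congr1 (fun i => shift_by i _)); lia.
  split; last by case=> // k _; rewrite !address_of_S E.
  by rewrite !mkseq_cons /= address_of_0 E /vershik /= hm.
have [h1 hj Et] := desubstP ht.
have hlt' k : (k < m)%N -> ~~ not_last S (address_of S (desubst S tau).1 k).
  by move=> hk; rewrite -address_of_S; exact: hlt.
have hm' : not_last S (address_of S (desubst S tau).1 m).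
  by rewrite -address_of_S.
have [E1 E2] := IH _ h1 hlt' hm'.
have hs1 : subshift S (shift_map (desubst S tau).1) by exact: subshift_shift.
have hl := hlt 0%N isT.
have E : desubst S (shift_map tau) = (shift_map (desubst S tau).1, 0%N).
  apply: desubstE => //; [exact: subshift_shift|exact: size_subst_gt0|].
  rewrite {1}Et /shift_map shift_byD subst_biseq_shift1 // shift_by0.
  apply: (congr1 (fun i => shift_by i _)).
  have hj' : ((desubst S tau).2 < size (S ((desubst S tau).1 0%R)))%N := hj.
  by move: hl hj'; rewrite /not_last address_of_0 /=; lia.
split; last by case=> // k mk; rewrite !address_of_S E E2.
rewrite mkseq_cons [in RHS]mkseq_cons address_of_0 E /=.
have Es z : mkseq (fun k => address_of S z k.+1) m.+1 =
    mkseq (address_of S (desubst S z).1) m.+1.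
  by apply: eq_mkseq => k; rewrite address_of_S.
rewrite !Es E /= vershik_cons //; last first.
  by rewrite mkseqS has_rcons hm'.
rewrite -E1; congr ((_, _) :: _).
by rewrite mkseq_cons /= letter_address_of_0.
Qed.

End Addresses.

(** * Compactness of the cells *)

Section Topology.
Variables (A : alphabetType) (S : A -> seq A).
Hypothesis hS : is_substitution S.
Implicit Types (x y : biseq A).

Lemma near_coord (k : int) x : \forall y \near x, y k = x k.
Proof.
have h := @proj_continuous int (fun _ => discrete_topology A) k x.
apply: (h [set x k]).
have : open [set (x k : discrete_topology A)] by exact: discrete_open.
by move=> o; apply: open_nbhs_nbhs; split.
Qed.

Lemma near_window (k : int) m x : \forall y \near x,
  mkseq (fun i => y (k + Posz i)) m = mkseq (fun i => x (k + Posz i)) m.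
Proof.
elim: m => [|m IH]; first by apply: (@nearW _ (nbhs x)).
apply: filterS2 IH (near_coord (k + Posz m) x) => y E1 E2.
by rewrite !mkseqS E1 E2.
Qed.

(** Continuity in the product of discrete spaces means that each coordinate of
    the image is locally constant. *)
Lemma continuous_coord (f : biseq A -> biseq A) :
  (forall i x, \forall y \near x, f y i = f x i) -> continuous f.
Proof.
move=> hf x.
have NF : Filter (nbhs x) := @nbhs_filter (biseq A) x.
have FF := @fmap_filter _ _ f (nbhs x) NF.
apply: (iffRL (@cvg_sup _ _ _ _ _ FF)).
move=> i U [V [[W oW <-] Vx] VU]; rewrite nbhs_filterE.
apply: filterS VU _.
have := hf i x; apply: filterS => y /= ->.
exact: Vx.
Qed.

Lemma biseq_hausdorff : hausdorff_space (biseq A).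
Proof.
apply: (@hausdorff_product int (fun _ => discrete_topology A)) => k.
exact: discrete_hausdorff.
Qed.

Lemma biseq_compact : compact [set: biseq A].
Proof.
have fA : finite_set [set: discrete_topology A] := @finite_finset A setT.
have := @tychonoff int (fun _ => discrete_topology A) (fun _ => setT)
  (fun _ => finite_compact fA).
set B := (X in compact X -> _).
by suff -> : B = setT by []; apply/seteqP.
Qed.

Lemma closed_biseq_compact (B : set (biseq A)) : closed B -> compact B.
Proof. by move=> cB; apply: (subclosed_compact cB biseq_compact). Qed.

Lemma continuous_shift_by k : continuous (@shift_by A k).
Proof. by apply: continuous_coord => i x; exact: near_coord. Qed.

Lemma continuous_subst_biseq : continuous (subst_biseq S).
Proof.
apply: continuous_coord => -[n|n] x.
  near=> y; rewrite /=; have -> : y 0 = x 0 by near: y; exact: near_coord.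
  have -> // : mkseq (fun k => y (Posz k)) n.+1 =
               mkseq (fun k => x (Posz k)) n.+1.
  have w0 (z : biseq A) : mkseq (fun k => z (Posz k)) n.+1 =
                          mkseq (fun k => z (0 + Posz k)) n.+1.
    by apply: eq_mkseq => k; rewrite add0r.
  by rewrite !w0; near: y; exact: near_window.
near=> y; rewrite /=; have -> : y 0 = x 0 by near: y; exact: near_coord.
have -> // : mkseq (fun k => y (Negz k)) n.+1 =
             mkseq (fun k => x (Negz k)) n.+1.
have E : mkseq (fun i => y (Negz n + Posz i)) n.+1 =
         mkseq (fun i => x (Negz n + Posz i)) n.+1.
  by near: y; exact: near_window.
apply: (@eq_from_nth _ (x 0)); rewrite !size_mkseq // => i hi.
rewrite !nth_mkseq //; have := congr1 (fun s => nth (x 0) s (n - i)) E.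
rewrite !nth_mkseq; [|lia..].
by have -> : (Negz n + Posz (n - i))%R = Negz i by lia.
Unshelve. all: by end_near. Qed.

Lemma closed_near (B : set (biseq A)) :
  (forall x, ~ B x -> \forall y \near x, ~ B y) -> closed B.
Proof.
by move=> h; rewrite -[B]setCK; apply: open_closedC; rewrite openE => x /h.
Qed.

Lemma closed_subshift : closed (subshift S).
Proof.
apply: closed_near => x.
move=> /existsNP[k /existsNP[m hkm]].
apply: filterS (near_window k m x) => y E hy; apply: hkm.
by rewrite -E.
Qed.

Lemma closed_cylinder a : closed (cylinder S a).
Proof.
have -> : cylinder S a = subshift S `&` [set x | x 0 = a] by [].
apply: closedI; first exact: closed_subshift.
by apply: closed_near => x h; apply: filterS (near_coord 0 x) => y /= ->.
Qed.

Lemma continuous_rebuild s : continuous (rebuild S s).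
Proof.
elim: s => [|p s IH] x; first exact: cvg_id.
apply: (@continuous_comp _ _ _ (rebuild S s)
   (fun z => shift_by (Posz p.2) (subst_biseq S z)) x (IH x)).
apply: (@continuous_comp _ _ _ (subst_biseq S) (shift_by (Posz p.2))).
  exact: continuous_subst_biseq.
exact: continuous_shift_by.
Qed.

Lemma continuous_iter_subst n : continuous (iter n (subst_biseq S)).
Proof.
elim: n => [|n IH] x; first exact: cvg_id.
apply: (@continuous_comp _ _ _ (iter n (subst_biseq S)) (subst_biseq S) x
  (IH x)).
exact: continuous_subst_biseq.
Qed.

Lemma image_closed (f : biseq A -> biseq A) (B : set (biseq A)) :
  continuous f -> closed B -> closed (f @` B).
Proof.
move=> cf cB; apply: (compact_closed biseq_hausdorff).
apply: continuous_compact; last exact: closed_biseq_compact.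
exact: continuous_subspaceT.
Qed.

Lemma closed_measurable (B : set (biseq A)) : closed B ->
  measurable (B : set (borel_biseq A)).
Proof.
move=> cB; rewrite -[B]setCK; apply: measurableC.
by apply: sub_sigma_algebra; exact: closed_openC.
Qed.

Hypothesis hrec : recognizable S.

(** The cell of a nonempty address is the image of a cylinder, which is compact,
    under a continuous map.  This provides the measurability of the cells. *)
Lemma closed_cell s : closed (cell S s).
Proof.
have [hs|hs] := boolP (is_address S s); last first.
  by rewrite cell_nonaddress //; exact: closed0.
case: s hs => [|p s] hs.
  have -> : cell S [::] = subshift S by apply/seteqP; split=> [x []|x hx].
  exact: closed_subshift.
rewrite cell_rebuild //; apply: image_closed; last exact: closed_cylinder.
exact: continuous_rebuild.
Qed.

(** The cells of the prefixes of s form a decreasing sequence of nonempty closed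
    sets in a compact space; a cluster point of a choice of points lies in all
    of them. *)
Lemma address_realized (s : nat -> A * nat) :
  (forall n, cell S (mkseq s n) !=set0) ->
  exists2 tau, subshift S tau & address_of S tau = s.
Proof.
move=> h; pose t n := sval (cid (h n)).
have ht n : cell S (mkseq s n) (t n) by rewrite /t; case: cid.
have cell_mono m n x : (m <= n)%N ->
    cell S (mkseq s n) x -> cell S (mkseq s m) x.
  move=> mn [hx]; rewrite size_mkseq => E; split=> //; rewrite size_mkseq.
  have /= := congr1 (take m) E.
  by rewrite /mkseq -!map_take !take_iota (minn_idPl mn).
have [|x [_ hx]] := @biseq_compact (t @ \oo) _; first exact: filterT.
have cx n : cell S (mkseq s n) x.
  apply: (closed_cell _) => B hB.
  apply: hx hB; exists n => // m /= nm; exact: (cell_mono n m).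
exists x; first by case: (cx 0%N).
apply/funext => n; have [_] := cx n.+1.
rewrite size_mkseq => /(congr1 (fun w => nth (s n) w n)).
by rewrite !nth_mkseq.
Qed.

End Topology.

(** * Countable unions and geometric decay *)

Section CountableUnion.
Variables (I : countType) (T : Type) (F : I -> set T).

(** A family indexed by a countable type as a sequence of sets; with
    [pickle_inv] each index is used exactly once, which keeps disjoint families
    disjoint. *)
Definition enum_family (k : nat) : set T :=
  if pickle_inv k is Some i then F i else set0.

Lemma bigcup_enum_family : \bigcup_k enum_family k = \bigcup_i F i.
Proof.
apply/seteqP; split=> x [k _]; rewrite /enum_family.
  by case: pickle_inv => // i Fx; exists i.
by move=> Fx; exists (pickle k) => //; rewrite pickleK_inv.
Qed.

Lemma trivIset_enum_family : trivIset setT F -> trivIset setT enum_family.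
Proof.
move=> tF k l _ _ [x []]; rewrite /enum_family.
have := @pickle_invK I k; have := @pickle_invK I l.
case: (pickle_inv k) => [i|] //=; case: (pickle_inv l) => [j|] //= <- <- Fi Fj.
by congr (pickle _); apply: tF => //; exists x.
Qed.

End CountableUnion.

Lemma measurable_countable_union d (T : measurableType d) (I : countType)
    (F : I -> set T) :
  (forall i, measurable (F i)) -> measurable (\bigcup_i F i).
Proof.
by move=> mF; apply: countable_bigcupT_measurable mF; exact: countableP.
Qed.

Lemma negligible_countable_union d (T : measurableType d) (R : realType)
    (nu : {measure set T -> \bar R}) (I : countType) (F : I -> set T) :
  (forall i, nu.-negligible (F i)) -> nu.-negligible (\bigcup_i F i).
Proof.
move=> nF; rewrite -bigcup_enum_family; apply: negligible_bigcup => k.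
by rewrite /enum_family; case: pickle_inv => // ; exact: negligible_set0.
Qed.

Lemma geometric_small (R : realType) (lambda C e : R) : 1 < lambda -> 0 < e ->
  exists n, C / lambda ^+ n < e.
Proof.
move=> l1 e0; have l0 : 0 < lambda by exact: lt_trans l1.
have h : `|lambda^-1| < 1 by rewrite gtr0_norm ?invr_gt0// invf_lt1.
have /cvgr0_norm_lt/(_ e e0)[n _ /(_ n (leqnn n))] := @cvg_geometric R C _ h.
rewrite /geometric /= exprVn => /(le_lt_trans (ler_norm _)) hn.
by exists n.
Qed.

(** * Spaces coded by addresses *)

Section Coding.
Variables (R : realType) (A : alphabetType) (S : A -> seq A).
Variables (lm : A -> R) (lambda : R).
Hypothesis lambda_gt1 : 1 < lambda.
Hypothesis lm_ge0 : forall a, 0 <= lm a.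

(** The common value of the measure of a cell and of the length of an interval;
    see [mu_cell] and [interval_coding]. *)
Definition weight (s : seq (A * nat)) : R :=
  if s is p :: s' then lm (last p s').1 / lambda ^+ size s else 0.

Lemma weight_mkseq (s : nat -> A * nat) n :
  weight (mkseq s n.+1) = lm (s n).1 / lambda ^+ n.+1.
Proof.
rewrite /weight mkseqS; case: (mkseq s n) (size_mkseq s n) => [|p t] <- //=.
by rewrite last_rcons size_rcons.
Qed.

Section OneCoding.
Context d (T : measurableType d).
Variables (D : set T) (c : T -> nat -> A * nat).

(** Prefixes have length n + 1 because the empty address has no interval. *)
Definition prefix_set n (Q : set (seq (A * nat))) : set T :=
  [set x | D x /\ Q (mkseq (c x) n.+1)].

(** The common abstraction of the subshift and of [0,1): null sets and laws can
    be computed as soon as the points with a given prefix form a measurable set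
    whose measure depends only on the prefix. *)
Definition coding (nu : {measure set T -> \bar R}) :=
  (forall x, D x -> infinite_address S (c x)) /\
  forall n s, size s = n.+1 -> is_address S s ->
    measurable (prefix_set n [set s]) /\
    nu (prefix_set n [set s]) = (weight s)%:E.

Variable nu : {measure set T -> \bar R}.
Hypothesis hc : coding nu.

Definition prefix_family n (Q : set (seq (A * nat))) s :=
  if pselect (is_address S s /\ size s = n.+1 /\ Q s) then prefix_set n [set s]
  else set0.

Lemma bigcup_prefix_family n Q : \bigcup_s prefix_family n Q s = prefix_set n Q.
Proof.
apply/seteqP; split=> x.
  move=> [s _]; rewrite /prefix_family.
  by case: pselect => // -[_ [_ Qs]] [Dx E]; split=> //; rewrite [mkseq _ _]E.
move=> [Dx Qx]; exists (mkseq (c x) n.+1) => //; rewrite /prefix_family.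
case: pselect => // -[]; split; first by apply: is_address_mkseq; exact: hc.1.
by rewrite size_mkseq.
Qed.

Lemma trivIset_prefix_family n Q : trivIset setT (prefix_family n Q).
Proof.
move=> s t _ _ [x []]; rewrite /prefix_family.
by case: pselect => // _ [_ /= <-]; case: pselect => // _ [_ /= <-].
Qed.

Lemma measurable_prefix_family n Q s : measurable (prefix_family n Q s).
Proof.
rewrite /prefix_family.
case: pselect => [[h1 [h2 h3]]|h]; last exact: measurable0.
by have [] := hc.2 _ _ h2 h1.
Qed.

Lemma measurable_prefix_set n Q : measurable (prefix_set n Q).
Proof.
rewrite -bigcup_prefix_family; apply: measurable_countable_union => s.
exact: measurable_prefix_family.
Qed.

(** The right-hand side does not mention the space: this is how measures are
    compared on two coded spaces.  Addresses are enumerated as elements of a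
    countable type, which avoids listing those of a given length. *)
Lemma prefix_setE n Q : nu (prefix_set n Q) = (\sum_(k <oo)
  if pickle_inv k is Some s then
    if pselect (is_address S s /\ size s = n.+1 /\ Q s) then (weight s)%:E
    else 0
  else 0)%E.
Proof.
have mF k : measurable (enum_family (prefix_family n Q) k).
  rewrite /enum_family; case: pickle_inv => [s|] //.
  exact: measurable_prefix_family.
rewrite -bigcup_prefix_family -bigcup_enum_family measure_semi_bigcup //;
  last 2 first.
- exact: trivIset_enum_family (@trivIset_prefix_family n Q).
- exact: bigcupT_measurable.
apply: eq_eseriesr => k _.
rewrite /enum_family; case: pickle_inv => [s|]; last exact: measure0.
rewrite /prefix_family; case: pselect => [[h1 [h2 h3]]|h]; last exact: measure0.
by have [] := hc.2 _ _ h2 h1.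
Qed.

Lemma coding_domain_measurable : measurable D.
Proof.
have -> : D = prefix_set 0 setT by apply/seteqP; split=> x // [].
exact: measurable_prefix_set.
Qed.

(** The digits j_k are prescribed by a rule that may look at the letter a_k.
    Digits that are eventually first or eventually last in their words, after
    arbitrary first digits, are of this form; see [extremal_rule]. *)
Definition follows (rho : nat -> A -> nat) (s : nat -> A * nat) :=
  forall k, (s k).2 = rho k (s k).1.

Definition follows_prefix (rho : nat -> A -> nat) (s : seq (A * nat)) :=
  forall k, (k < size s)%N -> forall p0, (nth p0 s k).2 = rho k (nth p0 s k).1.

Lemma measurable_follows rho : measurable (D `&` [set x | follows rho (c x)]).
Proof.
have -> : D `&` [set x | follows rho (c x)] =
    \bigcap_n prefix_set n (follows_prefix rho).
  apply/seteqP; split=> x.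
    move=> [Dx h] n _; split=> // k; rewrite size_mkseq => kn p0.
    by rewrite nth_mkseq.
  move=> h; split; first by case: (h 0%N Logic.I).
  move=> k; have [_ /(_ k)] := h k Logic.I.
  by rewrite size_mkseq => /(_ (ltnSn k) (c x k)); rewrite nth_mkseq.
by apply: bigcapT_measurable => n; exact: measurable_prefix_set.
Qed.

Lemma follows_prefix_rcons rho s p : follows_prefix rho (rcons s p) ->
  follows_prefix rho s /\ p.2 = rho (size s) p.1.
Proof.
move=> h; split=> [k ks p0|].
  have := h k; rewrite size_rcons ltnS => /(_ (ltnW ks) p0).
  by rewrite nth_rcons ks.
have := h (size s); rewrite size_rcons => /(_ (ltnSn _) p).
by rewrite nth_rcons ltnn eqxx.
Qed.

(** An address is read backwards from its last letter: the rule gives the last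
    digit, and the pair determines the letter of the preceding entry. *)
Lemma is_address_ext s t (rho : nat -> A -> nat) :
  is_address S s -> is_address S t -> size s = size t ->
  follows_prefix rho s -> follows_prefix rho t ->
  (forall p0, (last p0 s).1 = (last p0 t).1) -> s = t.
Proof.
elim/last_ind: s t => [|s p IH] t; first by case: t.
case/lastP: t => [|t q]; first by rewrite size_rcons.
rewrite !is_address_rcons !size_rcons => /and3P[hs _ hp] /and3P[ht _ hq].
move=> [st] /follows_prefix_rcons[hs1 hp2] /follows_prefix_rcons[ht1 hq2] hl.
have pq1 : p.1 = q.1 by have := hl p; rewrite !last_rcons.
have pq2 : p.2 = q.2 by rewrite hp2 hq2 st pq1.
have pq : p = q by case: (p) (q) pq1 pq2 => [? ?] [? ?] /= -> ->.
rewrite pq; congr rcons; apply: IH => //.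
move=> p0; case: (s) (t) st hp hq => [|u s'] [|v t'] //= _ /eqP <- /eqP <-.
  by rewrite pq.
Qed.

(** For each last letter a there is at most one address of length n + 1 that
    follows the rule, so the set has measure at most lm a / lambda^(n+1).  The
    induction on the list l of possible last letters adds these bounds. *)
Lemma follows_prefix_bound rho n (l : seq A) (C : R) : (forall a, lm a <= C) ->
  (nu (prefix_set n [set s | follows_prefix rho s /\
        (forall p0, (last p0 s).1 \in l)])
  <= ((size l)%:R * C / lambda ^+ n.+1)%:E)%E.
Proof.
move=> hC; have l0 : 0 < lambda by exact: lt_trans lambda_gt1.
pose Q (m : seq A) : set (seq (A * nat)) :=
  [set s | follows_prefix rho s /\ (forall p0, (last p0 s).1 \in m)].
rewrite -/(Q l).
elim: l => [|a l IH].
  have -> : prefix_set n (Q [::]) = set0.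
    by apply/seteqP; split=> // x [_ [_ /(_ (c x 0%N))]].
  by rewrite measure0 !mul0r.
set Qa : set (seq (A * nat)) := [set s | follows_prefix rho s /\
        (forall p0, (last p0 s).1 = a)].
have sub : prefix_set n (Q (a :: l)) `<=`
    prefix_set n Qa `|` prefix_set n (Q l).
  move=> x [Dx [h1 h2]]; set s := mkseq (c x) n.+1 in h1 h2.
  have sE p0 : last p0 s = c x n by rewrite /s mkseqS last_rcons.
  have := h2 (c x n); rewrite sE inE => /orP[/eqP Ea|El]; [left|right];
    by split=> //; split=> // p0; rewrite -/s sE.
apply: le_trans (le_measure _ _ _ sub) _; rewrite ?inE.
- exact: measurable_prefix_set.
- by apply: measurableU; exact: measurable_prefix_set.
apply: le_trans
  (measureU2 _ (measurable_prefix_set _ _) (measurable_prefix_set _ _)) _.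
rewrite /= -natr1 mulrDl mul1r mulrDl addrC EFinD; apply: leeD => //.
have [-> |/set0P[x [Dx Qx]]] := eqVneq (prefix_set n Qa) set0.
  rewrite measure0 lee_fin divr_ge0 ?exprn_ge0 ?(ltW l0) //.
  by apply: le_trans (hC a).
set s := mkseq (c x) n.+1 in Qx.
have hs : is_address S s by apply: is_address_mkseq; exact: hc.1.
have ss : size s = n.+1 by rewrite size_mkseq.
have -> : prefix_set n Qa = prefix_set n [set s].
  apply/seteqP; split=> y [Dy]; last first.
    by move=> E; split=> //; rewrite [mkseq _ _]E.
  move=> Qy; split=> //; apply: (is_address_ext (rho := rho)) => //.
  - by apply: is_address_mkseq; exact: hc.1.
  - by rewrite size_mkseq.
  - exact: Qy.1.
  - exact: Qx.1.
  - by move=> p0; rewrite Qx.2 Qy.2.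
have [_ ->] := hc.2 n s ss hs.
rewrite lee_fin /s weight_mkseq ler_pM2r ?invr_gt0 ?exprn_gt0 //.
Qed.

Lemma follows_null rho : nu (D `&` [set x | follows rho (c x)]) = 0%E.
Proof.
set N := D `&` _; have l0 : 0 < lambda by exact: lt_trans lambda_gt1.
pose C := \sum_a lm a.
have hC a : lm a <= C by rewrite /C (bigD1 a) //= lerDl sumr_ge0.
have bound n : (nu N <= ((size (enum A))%:R * C / lambda ^+ n.+1)%:E)%E.
  apply: le_trans (follows_prefix_bound rho n (enum A) hC).
  apply: le_measure; rewrite ?inE; [exact: measurable_follows|
    exact: measurable_prefix_set|].
  move=> x [Dx h]; split=> //; split=> [k|p0]; last by rewrite mem_enum.
  by rewrite size_mkseq => kn p0; rewrite nth_mkseq.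
have fN : (nu N \is a fin_num)%E.
  by rewrite ge0_fin_numE //; apply: le_lt_trans (bound 0%N) _; rewrite ltry.
apply/eqP; rewrite eq_le measure_ge0 andbT -(fineK fN) lee_fin leNgt.
apply/negP => pos.
have [n hn] := geometric_small ((size (enum A))%:R * C / lambda) lambda_gt1 pos.
have := bound n; rewrite -(fineK fN) lee_fin leNgt exprS invfM mulrA.
by rewrite hn.
Qed.

Definition extremal_rule (w : seq nat) (b : bool) (k : nat) (a : A) : nat :=
  if (k < size w)%N then nth 0%N w k else if b then (size (S a)).-1 else 0%N.

(** A countable union, as a rule only depends on a word and a boolean. *)
Lemma not_two_sidedE : D `&` [set x | ~ two_sided S (c x)] =
  \bigcup_(wb : seq nat * bool)
    (D `&` [set x | follows (extremal_rule wb.1 wb.2) (c x)]).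
Proof.
apply/seteqP; split=> x.
- move=> [Dx h].
  have [[K hK]|h2] :=
    pselect (exists K, forall k, (K <= k)%N -> (c x k).2 = 0%N).
    exists (mkseq (fun k => (c x k).2) K, false) => //; split=> // k /=.
    rewrite /extremal_rule size_mkseq; case: ltnP => kK; last exact: hK.
    by rewrite nth_mkseq.
  have [[K hK]|h3] :=
    pselect (exists K, forall k, (K <= k)%N -> ~~ not_last S (c x k)).
    exists (mkseq (fun k => (c x k).2) K, true) => //; split=> // k /=.
    rewrite /extremal_rule size_mkseq; case: ltnP => kK.
      by rewrite nth_mkseq.
    have := hK k kK; have := (hc.1 _ Dx k).1; rewrite /is_digit /not_last.
    by clear; lia.
  case: h; split=> K; apply: contrapT => hn.
    apply: h2; exists K => k Kk; apply/eqP; rewrite -leqn0 leqNgt.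
    by apply/negP => kp; apply: hn; exists k.
  apply: h3; exists K => k Kk.
  by apply/negP => kp; apply: hn; exists k.
- move=> [[w b] _ [Dx h]]; split=> // -[h1 h2] /=.
  have [k [wk]] := h1 (size w); have [k' [wk']] := h2 (size w).
  have := h k; have := h k'; rewrite /extremal_rule !ltnNge wk wk' /=.
  rewrite /not_last; case: b {h} => -> -> //.
  by rewrite ltnn.
Qed.

Lemma measurable_two_sided : measurable (D `&` [set x | two_sided S (c x)]).
Proof.
have -> : D `&` [set x | two_sided S (c x)] =
          D `\` (D `&` [set x | ~ two_sided S (c x)]).
  apply/seteqP; split=> x [Dx h]; split=> //; first by case.
  by apply: contrapT => k; exact: h.
apply: measurableD; first exact: coding_domain_measurable.
rewrite not_two_sidedE; apply: measurable_countable_union => -[w b].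
exact: measurable_follows.
Qed.

Lemma negligible_not_two_sided :
  nu.-negligible (D `&` [set x | ~ two_sided S (c x)]).
Proof.
rewrite not_two_sidedE; apply: negligible_countable_union => -[w b].
by apply/negligibleP; [exact: measurable_follows|exact: follows_null].
Qed.

End OneCoding.

Lemma coding_prefix_eq d1 (T1 : measurableType d1) (D1 : set T1) c1
    (nu1 : {measure set T1 -> \bar R})
    d2 (T2 : measurableType d2) (D2 : set T2) c2
    (nu2 : {measure set T2 -> \bar R}) :
  coding D1 c1 nu1 -> coding D2 c2 nu2 ->
  forall n Q, nu1 (prefix_set D1 c1 n Q) = nu2 (prefix_set D2 c2 n Q).
Proof. by move=> h1 h2 n Q; rewrite !prefix_setE. Qed.

End Coding.

(** * Subdivision of an interval *)

Section Subdivision.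
Variables (R : realType) (I : eqType) (w : I -> R).
Implicit Type (r : seq I).

(** The left endpoint of the interval of p, when intervals of lengths w are laid
    out from 0 in the order of r. *)
Definition offset r p : R := \sum_(q <- take (index p r) r) w q.

Lemma offset_cons q r p : p != q -> offset (q :: r) p = w q + offset r p.
Proof. by move=> pq; rewrite /offset /= eq_sym (negbTE pq) /= big_cons. Qed.

Lemma offset_head q r : offset (q :: r) q = 0.
Proof. by rewrite /offset /= eqxx /= big_nil. Qed.

Lemma subdivision_cover r y : uniq r -> 0 <= y -> y < \sum_(q <- r) w q ->
  exists2 p, p \in r & offset r p <= y < offset r p + w p.
Proof.
elim: r y => [|q r IH] y /=.
  by rewrite big_nil => _ /le_lt_trans h /h; rewrite ltxx.
rewrite big_cons => /andP[qr ur] y0 yr.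
have [yq|qy] := ltP y (w q).
  by exists q; rewrite ?mem_head // offset_head y0 add0r.
have [||p pr /andP[h1 h2]] := IH (y - w q) ur; rewrite ?subr_ge0 //.
  by rewrite ltrBlDl.
have pq : p != q by apply: contraNneq qr => <-.
exists p; first by rewrite inE pr orbT.
by rewrite offset_cons // -lerBrDl h1 -addrA -ltrBlDl.
Qed.

Hypothesis w_ge0 : forall p, 0 <= w p.

Lemma offset_ge0 r p : 0 <= offset r p.
Proof. by rewrite /offset sumr_ge0. Qed.

Lemma subdivision_le r p : p \in r -> offset r p + w p <= \sum_(q <- r) w q.
Proof.
elim: r => //= q r IH; rewrite inE big_cons.
have [->|pq] /= := eqVneq p q.
  by rewrite offset_head add0r lerDl sumr_ge0.
by move=> pr; rewrite offset_cons // -addrA lerD2l IH.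
Qed.

Lemma subdivision_disjoint r p p' y : p \in r -> p' \in r ->
  offset r p <= y < offset r p + w p -> offset r p' <= y < offset r p' + w p' ->
  p = p'.
Proof.
elim: r y => //= q r IH y; rewrite !inE.
have [->|pq] /= := eqVneq p q; have [->|p'q] //= := eqVneq p' q;
  rewrite ?offset_head.
- move=> _ _ /andP[_]; rewrite add0r offset_cons // => yq /andP[qy _].
  have := le_lt_trans qy yq; rewrite ltNge; have := offset_ge0 r p'.
  by rewrite lerDl => ->.
- move=> _ _ /andP[qy _] /andP[_]; rewrite add0r => yq.
  move: qy; rewrite offset_cons // => qy.
  have := le_lt_trans qy yq; rewrite ltNge; have := offset_ge0 r p.
  by rewrite lerDl => ->.
- rewrite !offset_cons // => pr p'r.
  have shift u : (w q + offset r u <= y < w q + offset r u + w u) =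
      (offset r u <= y - w q < offset r u + w u).
    by rewrite lerBrDl ltrBlDl addrA.
  by rewrite !shift; exact: IH.
Qed.

End Subdivision.

(** * Intervals of addresses *)

Section Intervals.
Variables (R : realType) (A : alphabetType) (S : A -> seq A).
Variables (mu : probability (borel_biseq A) R) (lambda : R).
Variables (Phi0 : A -> R) (Sstar : dual_substitution S).
Local Notation lm := (letter_measure S mu).
Local Notation Phi := (Phi_address mu lambda Phi0 Sstar).
Local Notation phi := (left_endpoint mu lambda Sstar).
Local Notation II := (address_interval mu lambda Phi0 Sstar).
Local Notation wt := (weight lm lambda).
Hypothesis lambda_gt1 : 1 < lambda.
Hypothesis lm_gt0 : forall a, 0 < lm a.
Hypothesis lm_split : forall a,
  lm a = \sum_(p <- dual_order Sstar a) lm p.1 / lambda.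
Hypothesis hPhi0 : partition [set: A]
      (fun a => [set` `[Phi0 a, Phi0 a + lm a[]) `[0, 1[.

Let l0 : 0 < lambda. Proof. exact: lt_trans lambda_gt1. Qed.

Lemma address_intervalE s x : s != [::] ->
  II s x <-> Phi s <= x < Phi s + wt s.
Proof. by case: s => //= p s _; rewrite in_itv. Qed.

Lemma Phi_address1 p : Phi [:: p] = Phi0 (letter S p) + phi p.
Proof. by rewrite /= big_nat1 expr0 divr1. Qed.

Lemma Phi_address_rcons s p : s != [::] ->
  Phi (rcons s p) = Phi s + phi p / lambda ^+ size s.
Proof.
case: s => // q s _; rewrite [LHS]/= -rcons_cons size_rcons big_nat_recr //=.
rewrite nth_rcons ltnn eqxx addrA; congr (_ + _ + _).
rewrite !big_nat; apply: eq_bigr => k /andP[_ kn].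
by rewrite -rcons_cons nth_rcons /= kn.
Qed.

Lemma weight_rcons s p : wt (rcons s p) = lm p.1 / lambda / lambda ^+ size s.
Proof.
rewrite /weight; case: s => [|q s] /=; first by rewrite expr1 expr0 divr1.
by rewrite last_rcons size_rcons exprS invfM mulrA.
Qed.

Lemma left_endpoint_offset p :
  phi p = offset (fun q => lm q.1 / lambda) (dual_order Sstar (letter S p)) p.
Proof. by []. Qed.

Let wge0 (q : A * nat) : 0 <= lm q.1 / lambda.
Proof. by rewrite divr_ge0 ?ltW. Qed.

Lemma left_endpoint_ge0 p : 0 <= phi p.
Proof. exact: offset_ge0. Qed.

(** The intervals attached to T(a) cover [0, lm a) because their lengths add up
    to lm a. *)
Lemma dual_digit a y : 0 <= y < lm a ->
  exists2 p, incoming S a p & phi p <= y < phi p + lm p.1 / lambda.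
Proof.
move=> /andP[y0 ya]; rewrite lm_split in ya.
have [p pa hp] := subdivision_cover (dual_order_uniq Sstar a) y0 ya.
rewrite mem_dual_order in pa; exists p => //.
by rewrite left_endpoint_offset; have /andP[_ /eqP ->] := pa.
Qed.

Lemma dual_digit_uniq a p p' y : incoming S a p -> incoming S a p' ->
  phi p <= y < phi p + lm p.1 / lambda ->
  phi p' <= y < phi p' + lm p'.1 / lambda -> p = p'.
Proof.
move=> hp hp'; rewrite !left_endpoint_offset.
have /andP[_ /eqP ->] := hp; have /andP[_ /eqP ->] := hp'.
by apply: subdivision_disjoint; rewrite ?mem_dual_order.
Qed.

Lemma dual_digit_le a p : incoming S a p -> phi p + lm p.1 / lambda <= lm a.
Proof.
move=> hp; rewrite [leRHS]lm_split left_endpoint_offset.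
have /andP[_ /eqP ->] := hp.
by apply: (subdivision_le wge0); rewrite mem_dual_order.
Qed.

(** Reduces a statement on intervals of level n to the intervals attached to
    T(a), by the homothety of ratio lambda^n. *)
Lemma interval_rescale (P f m L x : R) : 0 < L ->
  (P + f / L <= x < P + f / L + m / L) = (f <= (x - P) * L < f + m).
Proof.
move=> L0; rewrite -addrA -mulrDl -lerBrDl -ltrBlDl.
by rewrite ler_pdivrMr // ltr_pdivlMr.
Qed.

Lemma interval_rcons s p x : s != [::] -> II (rcons s p) x <->
  phi p <= (x - Phi s) * lambda ^+ size s < phi p + lm p.1 / lambda.
Proof.
move=> s0; rewrite address_intervalE; last by case: (s).
by rewrite Phi_address_rcons // weight_rcons interval_rescale // exprn_gt0.
Qed.

Lemma interval1 p x : II [:: p] x <->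
  phi p <= x - Phi0 (letter S p) < phi p + lm p.1 / lambda.
Proof.
rewrite address_intervalE // Phi_address1 (weight_rcons [::]) expr0.
by rewrite -{1 2}[phi p]divr1 interval_rescale // mulr1.
Qed.

Lemma interval_last s q x : II (rcons s q) x <->
  0 <= (x - Phi (rcons s q)) * lambda ^+ size (rcons s q) < lm q.1.
Proof.
rewrite address_intervalE; last by case: (s).
rewrite -{1 2}[Phi _]addr0 -{1 2}(mul0r (lambda ^+ size (rcons s q))^-1).
rewrite weight_rcons -mulrA -invfM -exprS -(size_rcons s q).
by rewrite interval_rescale ?exprn_gt0 // add0r.
Qed.

Lemma interval_refine s x : s != [::] -> is_address S s -> II s x ->
  exists2 p, is_address S (rcons s p) & II (rcons s p) x.
Proof.
case/lastP: s => // s q _ hs /interval_last/dual_digit[p /andP[hp hl] hx].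
exists p; last by apply/interval_rcons => //; case: (s).
rewrite is_address_rcons hs hp /=.
by case: (s) => [|u t] /=; rewrite ?last_rcons.
Qed.

Lemma address_rcons_incoming s q p : is_address S (rcons (rcons s q) p) ->
  incoming S q.1 p.
Proof.
rewrite is_address_rcons /incoming => /and3P[_ -> ] /=.
by case: (s) => [|u t] /=; rewrite ?last_rcons.
Qed.

(** Refinement: the interval of a longer address lies in that of its prefix,
    since the interval of each digit of T(a) ends before lm a. *)
Lemma interval_prefix s p x : s != [::] -> is_address S (rcons s p) ->
  II (rcons s p) x -> II s x.
Proof.
case/lastP: s => // s q s0 hs /(interval_rcons _ _ s0)/andP[h1 h2].
apply/interval_last; rewrite (le_trans (left_endpoint_ge0 p)) //=.
apply: lt_le_trans h2 _; apply: dual_digit_le.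
exact: address_rcons_incoming hs.
Qed.

Lemma interval_rcons_inj s p p' x : s != [::] ->
  is_address S (rcons s p) -> is_address S (rcons s p') ->
  II (rcons s p) x -> II (rcons s p') x -> p = p'.
Proof.
case/lastP: s => // s q s0 hs hs' /(interval_rcons _ _ s0) h.
move=> /(interval_rcons _ _ s0) h'.
apply: dual_digit_uniq h h'; first exact: address_rcons_incoming hs.
exact: address_rcons_incoming hs'.
Qed.

Lemma Phi0_cover x : 0 <= x < 1 -> exists a, 0 <= x - Phi0 a < lm a.
Proof.
move=> hx; have [hc _ _] := hPhi0.
have : `[0, 1[%classic x by rewrite /= in_itv.
rewrite -hc => -[a _] /=; rewrite in_itv /= => /andP[h1 h2]; exists a.
by rewrite subr_ge0 h1 ltrBlDl.
Qed.

Lemma Phi0_sub a x : 0 <= x - Phi0 a < lm a -> 0 <= x < 1.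
Proof.
move=> /andP[h1 h2]; have [hc _ _] := hPhi0.
have : `[0, 1[%classic x.
  rewrite -hc; exists a => //=; rewrite in_itv /= -subr_ge0 h1.
  by rewrite -ltrBlDl.
by rewrite /= in_itv.
Qed.

Lemma Phi0_inj a b x : 0 <= x - Phi0 a < lm a -> 0 <= x - Phi0 b < lm b ->
  a = b.
Proof.
move=> /andP[h1 h2] /andP[k1 k2]; have [_ ht _] := hPhi0.
apply: ht => //; exists x; split; rewrite /= in_itv /=.
  by rewrite -subr_ge0 h1 -ltrBlDl.
by rewrite -subr_ge0 k1 -ltrBlDl.
Qed.

Lemma Phi0_ge0 a : 0 <= Phi0 a.
Proof.
have h : 0 <= Phi0 a - Phi0 a < lm a by rewrite subrr lexx lm_gt0.
by have /andP[] := Phi0_sub h.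
Qed.

Lemma interval1_letter p x : is_digit S p -> II [:: p] x ->
  0 <= x - Phi0 (letter S p) < lm (letter S p).
Proof.
move=> hp /interval1/andP[h1 h2]; rewrite (le_trans (left_endpoint_ge0 p)) //=.
by apply: lt_le_trans h2 _; apply: dual_digit_le; rewrite /incoming hp /=.
Qed.

Lemma interval_sub01 s x : s != [::] -> is_address S s -> II s x -> 0 <= x < 1.
Proof.
elim/last_ind: s => // s p IH _; case/lastP: s IH => [|s q] IH hs hx.
  apply: (Phi0_sub (interval1_letter _ hx)).
  by move: hs; rewrite is_address_rcons => /and3P[].
have s0 : rcons s q != [::] by case: (s).
apply: IH => //; last exact: interval_prefix hx.
by move: hs; rewrite is_address_rcons => /and3P[].
Qed.

Lemma interval_cover n x : 0 <= x < 1 ->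
  exists s, [/\ is_address S s, size s = n.+1 & II s x].
Proof.
move=> hx; elim: n => [|n [s [h1 h2 h3]]].
  have [a /dual_digit[p /andP[hp /eqP ha] h]] := Phi0_cover hx.
  exists [:: p]; split=> //; first by rewrite /is_address /= hp.
  by apply/interval1; rewrite ha.
have s0 : s != [::] by case: (s) h2.
have [p hp hx'] := interval_refine s0 h1 h3.
by exists (rcons s p); rewrite size_rcons h2.
Qed.

Lemma interval_inj s t x :
  is_address S s -> is_address S t -> size s = size t ->
  II s x -> II t x -> s = t.
Proof.
elim/last_ind: s t => [|s p IH] t; first by case: t.
case/lastP: t => [|t q]; first by rewrite size_rcons.
rewrite !size_rcons => hs ht [st] hx hy.
have [s0|s0] := eqVneq s [::].
  have t0 : t = [::] by move: st; rewrite s0; case: (t).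
  subst s t; congr rcons.
  have hp : is_digit S p by move: hs; rewrite is_address_rcons => /and3P[].
  have hq : is_digit S q by move: ht; rewrite is_address_rcons => /and3P[].
  have e := Phi0_inj (interval1_letter hp hx) (interval1_letter hq hy).
  have k := iffLR (interval1 _ _) hy; rewrite -e in k.
  apply: (dual_digit_uniq (a := letter S p)) (iffLR (interval1 _ _) hx) k.
    by rewrite /incoming hp /=.
  by rewrite /incoming hq /= e.
have t0 : t != [::] by move: s0; rewrite -!size_eq0 st.
have e : s = t.
  apply: IH => //; [| |exact: interval_prefix hx|exact: interval_prefix hy].
    by move: hs; rewrite is_address_rcons => /and3P[].
  by move: ht; rewrite is_address_rcons => /and3P[].
by subst t; congr rcons; apply: interval_rcons_inj hx hy.
Qed.

Lemma point_address_uniq x s t :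
  point_address mu lambda Phi0 Sstar x s ->
  point_address mu lambda Phi0 Sstar x t -> s = t.
Proof.
move=> hs ht; apply/funext => n.
have : mkseq s n.+1 = mkseq t n.+1.
  have [h1 h2] := hs n; have [k1 k2] := ht n.
  by apply: interval_inj h2 k2; rewrite ?size_mkseq.
by move=> /(congr1 (fun w => nth (s n) w n)); rewrite !nth_mkseq.
Qed.

(** The addresses of length n that contain x are unique, hence extend each
    other, and their last entries form an infinite address. *)
Lemma point_address_exists x : 0 <= x < 1 ->
  exists s, point_address mu lambda Phi0 Sstar x s.
Proof.
move=> hx; have [f hf] := choice (fun n => interval_cover n hx).
have fS n : exists p, f n.+1 = rcons (f n) p.
  have [h1 h2 h3] := hf n.+1; have [k1 k2 k3] := hf n.
  case/lastP: (f n.+1) h1 h2 h3 => // t p; rewrite size_rcons => h1 [h2] h3.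
  exists p; congr rcons; apply: interval_inj k3 => //; last 2 first.
  - by rewrite h2.
  - by apply: interval_prefix h3 => //; rewrite -size_eq0 h2.
  by move: h1; rewrite is_address_rcons => /and3P[].
pose s n := last (point, 0%N) (f n).
have sE n : mkseq s n.+1 = f n.
  elim: n => [|n IH].
    have [_ h2 _] := hf 0%N; rewrite /mkseq /= /s.
    by case: (f 0%N) h2 => [|p [|]].
  by rewrite mkseqS IH /s; have [p ->] := fS n; rewrite last_rcons.
by exists s => n; rewrite sE; have [] := hf n.
Qed.

Lemma point_address_infinite x s : point_address mu lambda Phi0 Sstar x s ->
  infinite_address S s.
Proof. by move=> h; apply: infinite_addressP => n; have [] := h n. Qed.

Lemma point_address_sub01 x s : point_address mu lambda Phi0 Sstar x s ->
  0 <= x < 1.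
Proof. by move=> /(_ 0%N)[h1 h2]; apply: interval_sub01 h1 h2. Qed.

Lemma address_atP x s : point_address mu lambda Phi0 Sstar x s ->
  address_at mu lambda Phi0 Sstar x = Some s.
Proof.
move=> h; rewrite /address_at.
have : (Some @` point_address mu lambda Phi0 Sstar x) (Some s) by exists s.
by move=> /(xgetI None)[t ht <-]; congr Some; apply: point_address_uniq ht h.
Qed.

(** The value of an infinite address; the canonical isomorphism is by definition
    the value of [address_of]. *)
Definition limPhi (s : nat -> A * nat) : R :=
  lim ((fun n => Phi (mkseq s n)) @ \oo).

Lemma Phi_mkseqS s n : Phi (mkseq s n.+2) =
  Phi (mkseq s n.+1) + phi (s n.+1) / lambda ^+ n.+1.
Proof. by rewrite mkseqS Phi_address_rcons ?size_mkseq // mkseq_cons. Qed.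

Lemma Phi_nondecreasing s : nondecreasing_seq (fun n => Phi (mkseq s n)).
Proof.
apply/nondecreasing_seqP => -[|n].
  by rewrite [mkseq s 1]/= Phi_address1 addr_ge0 ?Phi0_ge0 ?left_endpoint_ge0.
by rewrite Phi_mkseqS lerDl divr_ge0 ?left_endpoint_ge0 ?exprn_ge0 ?ltW.
Qed.

(** The intervals of the prefixes are nested, so their right endpoints decrease.
    With [Phi_nondecreasing] this locates the value in the closure of each of
    them, and only in the closure. *)
Lemma right_nonincreasing s : infinite_address S s ->
  nonincreasing_seq (fun n => Phi (mkseq s n.+1) + wt (mkseq s n.+1)).
Proof.
move=> hs; apply/nonincreasing_seqP => n.
rewrite Phi_mkseqS !weight_mkseq -addrA lerD2l.
rewrite [lambda ^+ n.+2]exprS invfM mulrA -mulrDl.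
rewrite ler_pM2r ?invr_gt0 ?exprn_gt0 //; apply: dual_digit_le.
by rewrite /incoming (hs n.+1).1 (hs n).2 /=.
Qed.

Lemma Phi_bounded s : infinite_address S s ->
  forall m n, Phi (mkseq s m) <= Phi (mkseq s n.+1) + wt (mkseq s n.+1).
Proof.
move=> hs m n; pose k := maxn m n.
apply: le_trans (Phi_nondecreasing s (leq_trans (leq_maxl m n) (leqnSn k))) _.
apply: le_trans (right_nonincreasing hs (leq_maxr m n)).
rewrite lerDl weight_mkseq divr_ge0 ?exprn_ge0 ?ltW //.
Qed.

Lemma Phi_cvg s : infinite_address S s ->
  (fun n => Phi (mkseq s n)) @ \oo --> limPhi s.
Proof.
move=> hs; apply: nondecreasing_is_cvgn; first exact: Phi_nondecreasing.
exists (Phi (mkseq s 1) + wt (mkseq s 1)) => _ [n _ <-].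
exact: Phi_bounded.
Qed.

Lemma Phi_le_limPhi s n : infinite_address S s -> Phi (mkseq s n) <= limPhi s.
Proof.
move=> hs; apply: nondecreasing_cvgn_le; first exact: Phi_nondecreasing.
by apply: cvgP; exact: Phi_cvg.
Qed.

Lemma limPhi_le s n : infinite_address S s ->
  limPhi s <= Phi (mkseq s n.+1) + wt (mkseq s n.+1).
Proof.
move=> hs; apply: limr_le; first by apply: cvgP; exact: Phi_cvg.
by apply: nearW => m; exact: Phi_bounded.
Qed.

(** The lengths of the intervals tend to 0, so their closures have at most one
    common point. *)
Lemma limPhi_unique s x : infinite_address S s ->
  (forall n,
    Phi (mkseq s n.+1) <= x <= Phi (mkseq s n.+1) + wt (mkseq s n.+1)) ->
  x = limPhi s.
Proof.
move=> hs hx; apply: contrapT => /eqP xl.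
have e0 : 0 < `|x - limPhi s| by rewrite normr_gt0 subr_eq0.
pose C := \sum_a lm a.
have hC a : lm a <= C.
  by rewrite /C (bigD1 a) //= lerDl sumr_ge0 // => *; rewrite ltW.
have [n hn] := geometric_small (C / lambda) lambda_gt1 e0.
have : `|x - limPhi s| <= wt (mkseq s n.+1).
  have /andP[h1 h2] := hx n; have h3 := Phi_le_limPhi n.+1 hs.
  by have h4 := limPhi_le n hs; rewrite ler_norml; apply/andP; split; lra.
rewrite weight_mkseq leNgt (le_lt_trans _ hn) // exprS invfM mulrA.
by rewrite !ler_pM2r ?invr_gt0 ?exprn_gt0.
Qed.

Lemma limPhi_point_address x s : point_address mu lambda Phi0 Sstar x s ->
  limPhi s = x.
Proof.
move=> h; apply/esym/limPhi_unique; first exact: point_address_infinite h.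
move=> n; have [_ /address_intervalE] := h n.
by rewrite mkseq_cons => /(_ isT)/andP[-> /ltW ->].
Qed.

(** The left endpoint of the first interval is nonnegative.  If its right
    endpoint exceeded 1, the maximum of 1 and the left endpoint would be a point
    of the interval outside [0,1). *)
Lemma limPhi_sub01 s : infinite_address S s -> 0 <= limPhi s <= 1.
Proof.
move=> hs; apply/andP; split.
  apply: le_trans (Phi_le_limPhi 1 hs).
  by rewrite [mkseq s 1]/= Phi_address1 addr_ge0 ?Phi0_ge0 ?left_endpoint_ge0.
apply: le_trans (limPhi_le 0 hs) _; rewrite leNgt; apply/negP => h.
have hs1 : is_address S (mkseq s 1) by exact: is_address_mkseq.
pose y := Num.max 1 (Phi (mkseq s 1)).
have : II (mkseq s 1) y.
  apply/address_intervalE => //; rewrite /y le_max lexx orbT /= gt_max h /=.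
  by rewrite ltrDl divr_gt0 ?exprn_gt0.
move=> /(@interval_sub01 (mkseq s 1) y isT hs1)/andP[_].
by rewrite /y gt_max ltxx.
Qed.

(** From rank N on, the partial sums of the two values have the same
    increments. *)
Lemma limPhi_tail s t N : infinite_address S s -> infinite_address S t ->
  (forall k, (N < k)%N -> s k = t k) ->
  limPhi s - Phi (mkseq s N.+1) = limPhi t - Phi (mkseq t N.+1).
Proof.
move=> hs ht st; pose u n := Phi (mkseq s n) - Phi (mkseq t n).
have uN n : u (N.+1 + n)%N = u N.+1.
  elim: n => [|n IH]; first by rewrite addn0.
  rewrite addnS addSn /u !Phi_mkseqS -addSn st ?ltn_addr // opprD addrACA subrr.
  by rewrite addr0; exact: IH.
have c1 : u @ \oo --> limPhi s - limPhi t by apply: cvgB; exact: Phi_cvg.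
have c2 : u @ \oo --> u N.+1.
  apply: cvg_near_cst; exists N.+1 => // n /= Nn.
  by rewrite -(subnKC Nn) uN.
have e : limPhi s - limPhi t = u N.+1 by exact: cvg_unique c1 c2.
by move: e; rewrite /u => e; lra.
Qed.

End Intervals.

(** * Measure of the cells *)

Section CellMeasure.
Variables (R : realType) (A : alphabetType) (S : A -> seq A).
Variables (mu : probability (borel_biseq A) R) (lambda : R).
Local Notation lm := (letter_measure S mu).
Hypothesis hS : is_substitution S.
Hypothesis hrec : recognizable S.
Hypothesis hshift : shift_invariant mu.
Hypothesis hpos : forall a : A, (0 < mu (cylinder S a))%E.
Hypothesis hscale : forall (a : A) (n : nat),
      mu (iter n (subst_biseq S) @` cylinder S a) =
      (mu (cylinder S a) * (lambda ^- n)%:E)%E.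

Lemma mu_cylinder a : mu (cylinder S a) = (lm a)%:E.
Proof.
rewrite /letter_measure fineK //; apply: fin_num_measure.
exact: (@closed_measurable A _ (@closed_cylinder A S a)).
Qed.

Lemma letter_measure_gt0 a : 0 < lm a.
Proof. by rewrite -lte_fin -mu_cylinder. Qed.

(** The hypothesis of invariance is about preimages and measurable sets; closed
    sets are used because their images under the shift are again closed. *)
Lemma mu_shift_image (B : set (biseq A)) h : closed B ->
  mu (shift_by (Posz h) @` B) = mu B.
Proof.
move=> cB; elim: h => [|h IH].
  by congr (mu _); apply/seteqP; split=> [_ [x Bx <-]|x Bx];
    [|exists x => //]; rewrite shift_by0.
rewrite -IH; set C := shift_by (Posz h) @` B.
have cC : closed C by apply: image_closed cB; exact: continuous_shift_by.
have -> : shift_by (Posz h.+1) @` B = @shift_map A @` C.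
  apply/seteqP; split=> [_ [x Bx <-]|_ [_ [x Bx <-] <-]].
    exists (shift_by (Posz h) x); first by exists x.
    rewrite /shift_map shift_byD.
    by apply: (congr1 (fun i => shift_by i x)); lia.
  exists x => //.
  by rewrite /shift_map shift_byD; apply: (congr1 (fun i => shift_by i x)); lia.
have mC : measurable (@shift_map A @` C : set (borel_biseq A)).
  apply: (@closed_measurable A); apply: image_closed cC.
  exact: continuous_shift_by.
rewrite -(hshift mC); congr (mu _).
apply/seteqP; split=> [x [y Cy]|x Cx]; last by exists x.
move=> /(congr1 (shift_by (- 1))).
by rewrite /shift_map !shift_byD addNr !shift_by0 => <-.
Qed.

Lemma mu_cell s : is_address S s -> s != [::] ->
  mu (cell S s) = (weight lm lambda s)%:E.
Proof.
case: s => // p s hps _; rewrite cell_rebuild //.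
have [h hh] := @rebuild_shift A S hS (p :: s) (last p s).1 hps erefl.
have -> : rebuild S (p :: s) @` cylinder S (last p s).1 =
    shift_by (Posz h) @`
      (iter (size s).+1 (subst_biseq S) @` cylinder S (last p s).1).
  apply/seteqP; split=> [_ [y [hy y0] <-]|_ [_ [y [hy y0] <-] <-]].
    exists (iter (size s).+1 (subst_biseq S) y); first by exists y.
    by rewrite hh.
  by exists y => //; rewrite hh.
rewrite mu_shift_image; last first.
  apply: image_closed; last exact: closed_cylinder.
  exact: continuous_iter_subst.
by rewrite hscale mu_cylinder -EFinM.
Qed.

Lemma measurable_cell s : measurable (cell S s : set (borel_biseq A)).
Proof. exact: (@closed_measurable A _ (@closed_cell A S hS hrec s)). Qed.

(** The cylinder of a is the disjoint union of the cells of length 1 whose digit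
    belongs to T(a). *)
Lemma letter_measure_split (D : dual_substitution S) a :
  lm a = \sum_(p <- dual_order D a) lm p.1 / lambda.
Proof.
have E : cylinder S a = \bigcup_(p in [set` dual_order D a]) cell S [:: p].
  apply/seteqP; split=> [x [hx x0]|x [p /= hp] [hx]].
    exists (address_of S x 0); last by [].
    rewrite /= mem_dual_order /incoming (letter_address_of_0 hS hrec hx) x0.
    rewrite eqxx andbT.
    exact: address_of_digit.
  move=> [E]; split=> //; rewrite -(letter_address_of_0 hS hrec hx) E.
  by move: hp; rewrite mem_dual_order => /andP[_ /eqP].
apply: EFin_inj; rewrite -mu_cylinder E measure_fin_bigcup //; last 3 first.
- exact: finite_seq.
- by move=> p q _ _ [x [[_ [<-]] [_ [<-]]]].
- by move=> p _; exact: measurable_cell.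
rewrite -fsbig_seq ?dual_order_uniq //= -sumEFin big_seq [RHS]big_seq.
apply: eq_bigr => p; rewrite mem_dual_order => /andP[hp _].
by rewrite mu_cell //= ?expr1 // /is_address /= hp.
Qed.

Lemma subshift_coding :
  coding S lm lambda (subshift S : set (borel_biseq A)) (address_of S) mu.
Proof.
split=> [x hx|n s sn hs]; first exact: address_of_infinite.
have -> : prefix_set (subshift S : set (borel_biseq A)) (address_of S) n
    [set s] = cell S s by rewrite /cell sn.
split; first exact: measurable_cell.
by apply: mu_cell => //; rewrite -size_eq0 sn.
Qed.

End CellMeasure.

(** * Law of the value of an address *)

Section Preservation.
Variables (R : realType) (A : alphabetType) (S : A -> seq A).
Variables (mu : probability (borel_biseq A) R) (lambda : R).
Variables (Phi0 : A -> R) (Sstar : dual_substitution S).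
Local Notation lm := (letter_measure S mu).
Local Notation Phi := (Phi_address mu lambda Phi0 Sstar).
Local Notation II := (address_interval mu lambda Phi0 Sstar).
Local Notation limPhi := (limPhi mu lambda Phi0 Sstar).
Local Notation pa := (point_address mu lambda Phi0 Sstar).
Local Notation wt := (weight lm lambda).
Local Notation coding := (coding S lm lambda).
Hypothesis lambda_gt1 : 1 < lambda.
Hypothesis lm_gt0 : forall a, 0 < lm a.
Hypothesis lm_split : forall a,
  lm a = \sum_(p <- dual_order Sstar a) lm p.1 / lambda.
Hypothesis hPhi0 : partition [set: A]
      (fun a => [set` `[Phi0 a, Phi0 a + lm a[]) `[0, 1[.

(** The default value is only reached outside [0,1). *)
Definition address_of_point (x : R) : nat -> A * nat :=
  xget (fun _ => (point, 0%N)) (pa x).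

Lemma address_of_pointP x : 0 <= x < 1 -> pa x (address_of_point x).
Proof.
move=> /(point_address_exists lambda_gt1 lm_gt0 lm_split hPhi0)[s hs].
exact: (xgetI _ hs).
Qed.

Lemma address_of_pointE x s : pa x s -> address_of_point x = s.
Proof.
move=> h; apply: (point_address_uniq lambda_gt1 lm_gt0 lm_split hPhi0) (h).
exact: (xgetI _ h).
Qed.

Lemma interval_coding :
  coding (`[0%R, 1%R[%classic : set (measurableTypeR R)) address_of_point
    (@lebesgue_measure R).
Proof.
split=> [x|n s sn hs].
  by rewrite /= in_itv => /address_of_pointP; exact: point_address_infinite.
have s0 : s != [::] by rewrite -size_eq0 sn.
have E : prefix_set (`[0%R, 1%R[%classic : set (measurableTypeR R))
    address_of_point n [set s] = `[Phi s, Phi s + wt s[%classic.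
  apply/seteqP; split=> x; rewrite /= in_itv /=.
    move=> [hx <-]; have [_ h] := address_of_pointP hx n.
    by apply/address_intervalE => //; rewrite mkseq_cons.
  move=> hx; have hI : II s x by apply/address_intervalE.
  have hx01 := interval_sub01 lambda_gt1 lm_gt0 lm_split hPhi0 s0 hs hI.
  split; first by rewrite /= in_itv.
  have [h1 h2] := address_of_pointP hx01 n.
  apply: (interval_inj lambda_gt1 lm_gt0 lm_split hPhi0) h2 hI => //.
  by rewrite size_mkseq.
rewrite E; split; first exact: measurable_itv.
transitivity (lebesgue_measure ([set` `[Phi s, Phi s + wt s[] : set R)).
  by [].
rewrite lebesgue_measure_itv /= lte_fin ltrDl.
have -> : 0 < wt s.
  case: (s) s0 => // p t _; rewrite /weight divr_gt0 // exprn_gt0 //.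
  exact: lt_trans lambda_gt1.
by rewrite -EFinB addrAC subrr add0r.
Qed.

Section Value.
Context d (T : measurableType d) (D : set T) (c : T -> nat -> A * nat).
Variable nu : {measure set T -> \bar R}.
Hypothesis hc : coding D c nu.

(** Left endpoints increase to the value, so a strict lower bound is already
    seen on some prefix. *)
Lemma limPhi_gtE t : D `&` [set x | t < limPhi (c x)] =
  \bigcup_n prefix_set D c n [set s | t < Phi s].
Proof.
apply/seteqP; split=> [x [Dx hx]|x [n _ [Dx hx]]]; last first.
  split; first exact: Dx.
  apply: (lt_le_trans hx).
  exact: (Phi_le_limPhi lambda_gt1 lm_gt0 lm_split hPhi0 _ (hc.1 _ Dx)).
have h := Phi_cvg lambda_gt1 lm_gt0 lm_split hPhi0 (hc.1 _ Dx).
have [N _ hN] := cvgr_gt _ h _ hx.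
by exists N => //; split; [exact: Dx|exact: (hN N.+1 (leqnSn N))].
Qed.

Lemma measurable_limPhi_gt t : measurable (D `&` [set x | t < limPhi (c x)]).
Proof.
rewrite limPhi_gtE; apply: bigcupT_measurable => n.
exact: (measurable_prefix_set hc).
Qed.

Lemma measurable_limPhi :
  measurable_fun D ((fun x => limPhi (c x)) : T -> measurableTypeR R).
Proof.
apply: (measurability _ (measurable_realfun.RGenOInfty.measurableE R)).
move=> _ [_ [t ->] <-].
have -> : D `&` (fun x => limPhi (c x)) @^-1` `]t, +oo[%classic =
          D `&` [set x | t < limPhi (c x)].
  by apply/seteqP; split=> x [Dx] /=; rewrite in_itv /= andbT.
exact: measurable_limPhi_gt.
Qed.

Lemma measure_limPhi_gt t :
  (fun n => nu (prefix_set D c n [set s | t < Phi s])) @ \oo -->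
  nu (D `&` [set x | t < limPhi (c x)]).
Proof.
rewrite limPhi_gtE; apply: nondecreasing_cvg_mu.
- by move=> n; exact: (measurable_prefix_set hc).
- by apply: bigcupT_measurable => n; exact: (measurable_prefix_set hc).
- apply/nondecreasing_seqP => n; apply/subsetPset => x [Dx hx].
  split; first exact: Dx.
  apply: (lt_le_trans hx).
  have /nondecreasing_seqP : nondecreasing_seq (fun n => Phi (mkseq (c x) n)).
    exact: Phi_nondecreasing.
  exact.
Qed.

End Value.

End Preservation.

(** * Measures on the real line *)

Section ImageMeasure.
Context d d' (T : measurableType d) (U : measurableType d') (R : realType).
Variables (nu : {measure set T -> \bar R}) (D : set T) (f : T -> U).
Variables (mD : measurable D) (mf : measurable_fun D f).

(** The image under f of the restriction of nu to D.  The measurability proofs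
    are arguments so that the instance below can be inferred. *)
Definition image_measure of measurable D & measurable_fun D f :
    set U -> \bar R :=
  fun B => nu (D `&` f @^-1` B).
Local Notation im := (image_measure mD mf).

Let im0 : im set0 = 0%E.
Proof. by rewrite /image_measure preimage_set0 setI0 measure0. Qed.

Let im_ge0 B : (0 <= im B)%E.
Proof. exact: measure_ge0. Qed.

Let im_sigma_additive : semi_sigma_additive im.
Proof.
move=> F mF tF mUF; rewrite /image_measure preimage_bigcup setI_bigcupr.
apply: measure_semi_sigma_additive.
- by move=> n; exact: mf.
- apply/trivIsetP => /= i j _ _ ij; rewrite setIACA -preimage_setI.
  by move/trivIsetP : tF => /(_ _ _ _ _ ij) ->//; rewrite preimage_set0 setI0.
- by rewrite -setI_bigcupr -preimage_bigcup; exact: mf.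
Qed.

HB.instance Definition _ :=
  isMeasure.Build _ _ _ im im0 im_ge0 im_sigma_additive.

End ImageMeasure.

(** The open rays to the right are stable under intersection and generate the
    Borel sets. *)
Lemma real_measure_unique (R : realType)
    (m1 m2 : {measure set (measurableTypeR R) -> \bar R}) :
  (m1 setT < +oo)%E ->
  (forall t, m1 `]t, +oo[%classic = m2 `]t, +oo[%classic) ->
  forall B, measurable B -> m1 B = m2 B.
Proof.
move=> fin h.
pose G : set (set (measurableTypeR R)) :=
  [set `]x, +oo[%classic | x in [set: R]].
pose g (k : nat) : set (measurableTypeR R) := `](- k%:R), +oo[%classic.
apply: (@measure_unique _ R (measurableTypeR R) G g).
- rewrite measurable_realfun.RGenOInfty.measurableE; congr (<<s _ >>).
  by apply/seteqP; split=> [_ [x ->]|_ [x _ <-]]; exists x.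
- move=> _ _ [x _ <-] [y _ <-]; exists (Num.max x y) => //.
  apply/seteqP; split=> z /=; rewrite !in_itv /= !andbT gt_max.
    by move=> /andP.
  by move=> [-> ->].
- by move=> k; exists (- k%:R).
- apply/seteqP; split=> // x _.
  exists (Num.truncn `|x : R|).+1 => //; rewrite /g /= in_itv /= andbT.
  have := truncnS_gt `|x : R|; have := ler_norm (- (x : R)).
  by rewrite normrN; lra.
- by move=> _ [x _ <-].
- move=> k; apply: le_lt_trans fin; apply: le_measure; rewrite ?inE //.
  exact: measurable_itv.
Qed.

(** * The conjugacy *)

Section Conjugacy.
Variables (R : realType) (A : alphabetType) (S : A -> seq A).
Variables (mu : probability (borel_biseq A) R) (lambda : R).
Variables (Phi0 : A -> R) (Sstar : dual_substitution S).
Hypothesis hS : is_substitution S.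
Hypothesis hrec : recognizable S.
Hypothesis hshift : shift_invariant mu.
Hypothesis lambda_gt1 : 1 < lambda.
Hypothesis hpos : forall a : A, (0 < mu (cylinder S a))%E.
Hypothesis hscale : forall (a : A) (n : nat),
      mu (iter n (subst_biseq S) @` cylinder S a) =
      (mu (cylinder S a) * (lambda ^- n)%:E)%E.
Hypothesis hPhi0 : partition [set: A]
  (fun a => [set` `[Phi0 a, Phi0 a + letter_measure S mu a[]) `[0, 1[.
Local Notation lm := (letter_measure S mu).
Local Notation Phi := (Phi_address mu lambda Phi0 Sstar).
Local Notation limPhi := (limPhi mu lambda Phi0 Sstar).
Local Notation pa := (point_address mu lambda Phi0 Sstar).
Local Notation wt := (weight lm lambda).
Local Notation iso := (canonical_iso mu lambda Phi0 Sstar).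
Local Notation addr := (address_of_point mu lambda Phi0 Sstar).
Local Notation Sigma := (subshift S : set (borel_biseq A)).
Local Notation leb := (@lebesgue_measure R).
Local Notation I01 := (`[0%R, 1%R[%classic : set (measurableTypeR R)).

Let lm_gt0 := letter_measure_gt0 hpos.
Let lm_ge0 a : 0 <= lm a. Proof. exact: ltW. Qed.
Let lm_split := letter_measure_split hS hrec hshift hscale Sstar.
Let hc1 := subshift_coding hS hrec hshift hscale.
Let hc2 := interval_coding lambda_gt1 lm_gt0 lm_split hPhi0.

Lemma measurable_subshift : measurable Sigma.
Proof. exact: coding_domain_measurable hc1. Qed.

Lemma measurable_iso : measurable_fun Sigma (iso : _ -> measurableTypeR R).
Proof. exact: (measurable_limPhi lambda_gt1 lm_gt0 lm_split hPhi0 hc1). Qed.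

(** Both sides are the law of the value of the address, on the two coded spaces;
    on [0,1) the value of the address of x is x. *)
Lemma iso_preserves (B : set (measurableTypeR R)) : measurable B ->
  mu (Sigma `&` iso @^-1` B) = leb (I01 `&` B).
Proof.
move=> mB.
have m01 : measurable I01 by exact: coding_domain_measurable hc2.
have mf2 := measurable_limPhi lambda_gt1 lm_gt0 lm_split hPhi0 hc2.
have -> : I01 `&` B = I01 `&` (fun x => limPhi (addr x)) @^-1` B.
  have e x : I01 x -> limPhi (addr x) = x.
    rewrite /= in_itv => hx.
    apply: (limPhi_point_address lambda_gt1 lm_gt0 lm_split hPhi0).
    exact: address_of_pointP.
  by apply/seteqP; split=> x [hx]; rewrite /= e.
apply: (@real_measure_unique R
  (image_measure mu measurable_subshift measurable_iso)
  (image_measure leb m01 mf2)) mB => [|t].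
  rewrite /= /image_measure preimage_setT setIT.
  by apply: le_lt_trans (probability_le1 _ measurable_subshift) _; rewrite ltry.
rewrite /= /image_measure.
have e d (T : measurableType d) (D : set T) (c : T -> nat -> A * nat) :
    D `&` (fun x => limPhi (c x)) @^-1` `]t, +oo[%classic =
    D `&` [set x | t < limPhi (c x)].
  by apply/seteqP; split=> x [Dx] /=; rewrite in_itv /= andbT.
have h1 := measure_limPhi_gt lambda_gt1 lm_gt0 lm_split hPhi0 hc1 (t:=t).
have h2 := measure_limPhi_gt lambda_gt1 lm_gt0 lm_split hPhi0 hc2 (t:=t).
rewrite !e; apply: cvg_unique h1 _ => //.
have -> // :
    (fun n => mu (prefix_set Sigma (address_of S) n [set s | t < Phi s])) =
    (fun n => leb (prefix_set I01 addr n [set s | t < Phi s])).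
by apply/funext => n; exact: coding_prefix_eq hc1 hc2 _ _.
Qed.

Lemma negligible_point (x : R) : leb.-negligible [set x].
Proof.
by apply/negligibleP; [exact: measurable_set1|exact: lebesgue_measure_set1].
Qed.

Lemma closed_unit_interval (B : set (measurableTypeR R)) : measurable B ->
  leb (`[0%R, 1%R] `&` B) = leb (I01 `&` B).
Proof.
move=> mB.
have -> : `[0%R, 1%R]%classic `&` B = (I01 `&` B) `|` ([set 1] `&` B).
  apply/seteqP; split=> [x [/= ]|x [[/=]|[/=]]].
  - rewrite in_itv /= => /andP[x0]; rewrite le_eqVlt => /orP[/eqP ->|x1] Bx.
      by right.
    by left; split=> //; rewrite /= in_itv /= x0.
  - rewrite in_itv /= => /andP[x0 /ltW x1] Bx.
    by split; rewrite //= in_itv /= x0.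
  - by move=> -> Bx; split; rewrite //= in_itv /= ler01 lexx.
have m1 : measurable ([set 1] : set (measurableTypeR R)).
  exact: measurable_set1.
apply: measureU0.
- by apply: measurableI mB; exact: measurable_itv.
- exact: measurableI.
- apply: measure_negligible; first exact: measurableI.
  by apply: negligibleS (negligible_point 1) => x [].
Qed.

Definition right_endpoints : set (measurableTypeR R) :=
  \bigcup_(s : seq (A * nat)) [set Phi s + wt s].

Lemma measurable_right_endpoints : measurable right_endpoints.
Proof.
apply: measurable_countable_union => s; exact: measurable_set1.
Qed.

Lemma negligible_right_endpoints : leb.-negligible right_endpoints.
Proof.
by apply: negligible_countable_union => s; exact: negligible_point.
Qed.

Lemma measurable_iso_right : measurable (Sigma `&` iso @^-1` right_endpoints).
Proof.
exact: (measurable_iso measurable_subshift measurable_right_endpoints).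
Qed.

(** The right endpoints are countably many, and the isomorphism preserves
    measure. *)
Lemma negligible_iso_right :
  mu.-negligible (Sigma `&` iso @^-1` right_endpoints).
Proof.
apply/negligibleP; first exact: measurable_iso_right.
apply: etrans (iso_preserves measurable_right_endpoints) _.
apply: measure_negligible.
  apply: measurableI measurable_right_endpoints.
  exact: coding_domain_measurable hc2.
by apply: negligibleS negligible_right_endpoints => x [].
Qed.

(** The value lies in the closed interval of each prefix; when it is not a right
    endpoint it lies in the half-open interval, so that the address of tau is
    also the address of the point iso tau. *)
Lemma iso_point_address tau : subshift S tau -> ~ right_endpoints (iso tau) ->
  pa (iso tau) (address_of S tau).
Proof.
move=> ht hr n; have hi := address_of_infinite hS hrec ht.
split; first exact: is_address_mkseq.
apply/address_intervalE; first by rewrite mkseq_cons.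
rewrite (Phi_le_limPhi lambda_gt1 lm_gt0 lm_split hPhi0) //= lt_neqAle.
rewrite (limPhi_le lambda_gt1 lm_gt0 lm_split hPhi0) // andbT.
by apply/eqP => E; apply: hr; exists (mkseq (address_of S tau) n.+1).
Qed.

(** Cells of addresses have positive measure, hence are nonempty. *)
Lemma address_surjective (s : nat -> A * nat) : infinite_address S s ->
  exists2 tau, subshift S tau & address_of S tau = s.
Proof.
move=> hs.
have nz n : cell S (mkseq s n.+1) !=set0.
  have s0 : mkseq s n.+1 != [::] by rewrite mkseq_cons.
  apply/set0P/eqP => E.
  have := mu_cell hS hrec hshift hscale (is_address_mkseq n.+1 hs) s0.
  rewrite E measure0 weight_mkseq => -[] /esym/eqP.
  by rewrite gt_eqF // divr_gt0 // exprn_gt0 // (lt_trans _ lambda_gt1).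
apply: (address_realized hS hrec) => -[|n]; last exact: nz.
by have [x [hx _]] := nz 0%N; exists x.
Qed.

Lemma two_sided_first_not_last (s : nat -> A * nat) : two_sided S s ->
  exists2 m, first_not_last S s = Some m.+1 &
    not_last S (s m) /\ forall k, (k < m)%N -> ~~ not_last S (s k).
Proof.
move=> [_ /(_ 0%N)[k [_ hk]]]; rewrite /first_not_last.
case: pselect => [h|[]]; last by exists k.
exists (ex_minn h) => //; case: ex_minnP => m hm hmin; split=> // j jm.
by apply/negP => /hmin; rewrite leqNgt jm.
Qed.

Lemma exchange_defined x : I01 x -> two_sided S (addr x) ->
  interval_exchange mu lambda Phi0 Sstar x != None.
Proof.
rewrite /= in_itv => hx /two_sided_first_not_last[m hm _].
have hp := address_of_pointP lambda_gt1 lm_gt0 lm_split hPhi0 hx.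
rewrite /interval_exchange.
by rewrite (address_atP lambda_gt1 lm_gt0 lm_split hPhi0 hp) /= hm.
Qed.

(** The address of the shifted sequence and that of tau have the same entries
    after rank N, so their values differ by the difference of the left endpoints
    of length N, which is the translation in the interval exchange. *)
Lemma exchange_shift tau : subshift S tau -> two_sided S (address_of S tau) ->
  ~ right_endpoints (iso tau) ->
  interval_exchange mu lambda Phi0 Sstar (iso tau) = Some (iso (shift_map tau)).
Proof.
move=> ht /two_sided_first_not_last[m hm [hl hf]] hr.
have hp := iso_point_address ht hr.
rewrite /interval_exchange.
rewrite (address_atP lambda_gt1 lm_gt0 lm_split hPhi0 hp) /= hm /=.
have [<- tail] := address_of_shift hS hrec ht hf hl.
congr Some.
have hts : subshift S (shift_map tau) by exact: subshift_shift.
have := limPhi_tail lambda_gt1 lm_gt0 lm_split hPhi0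
  (address_of_infinite hS hrec hts) (address_of_infinite hS hrec ht) tail.
rewrite -/(iso (shift_map tau)) -/(iso tau) => <-.
by rewrite subrK.
Qed.

Let X1 := (Sigma `&` [set x | two_sided S (address_of S x)]) `\`
          (Sigma `&` iso @^-1` right_endpoints).
Let Y1 := (I01 `&` [set x | two_sided S (addr x)]) `\` right_endpoints.

(** X1 and Y1 are cut out by the same two conditions: the address is two-sided,
    and the point is not a right endpoint.  The second condition bears on all
    right endpoints rather than on those of the address of the point, which
    makes it the same on both sides. *)
Lemma iso_bij : set_bij X1 Y1 iso.
Proof.
split.
- move=> tau [[ht h2] hr]; have hr' : ~ right_endpoints (iso tau).
    by move=> h; apply: hr.
  have hp := iso_point_address ht hr'.
  split=> //; split; rewrite /= ?in_itv.
    exact: (point_address_sub01 lambda_gt1 lm_gt0 lm_split hPhi0 hp).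
  by rewrite (address_of_pointE lambda_gt1 lm_gt0 lm_split hPhi0 hp).
- move=> x y /set_mem[[hx h2] hrx] /set_mem[[hy _] hry] E.
  have hrx' : ~ right_endpoints (iso x) by move=> h; apply: hrx.
  have hry' : ~ right_endpoints (iso y) by move=> h; apply: hry.
  have px := iso_point_address hx hrx'; have py := iso_point_address hy hry'.
  apply: (address_of_inj hS hrec hx hy) => //; rewrite -E in py.
  exact: (point_address_uniq lambda_gt1 lm_gt0 lm_split hPhi0) px py.
- move=> x [[hx h2] hr]; rewrite /= in_itv in hx.
  have hp := address_of_pointP lambda_gt1 lm_gt0 lm_split hPhi0 hx.
  have [tau ht E] := address_surjective (point_address_infinite hp).
  have Ex : iso tau = x.
    have := limPhi_point_address lambda_gt1 lm_gt0 lm_split hPhi0 hp.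
    by rewrite -E.
  exists tau => //; split; first by split=> //; rewrite /= E.
  by move=> [_ /=]; rewrite Ex.
Qed.

Lemma unit_interval_exceptional :
  (`[0%R, 1%R]%classic : set (measurableTypeR R)) `\` Y1 `<=`
  [set 1] `|` ((I01 `&` [set x | ~ two_sided S (addr x)]) `|` right_endpoints).
Proof.
move=> x [/=]; rewrite in_itv /= => /andP[x0].
rewrite le_eqVlt => /orP[/eqP ->|x1] hY; first by left.
have hI : I01 x by rewrite /= in_itv /= x0.
right; have [hr|hr] := pselect (right_endpoints x); first by right.
by left; split=> // h; apply: hY.
Qed.

Lemma subshift_exceptional : Sigma `\` X1 `<=`
  (Sigma `&` [set x | ~ two_sided S (address_of S x)]) `|`
  (Sigma `&` iso @^-1` right_endpoints).
Proof.
move=> x [hx hX].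
have [hr|hr] := pselect (right_endpoints (iso x)); first by right.
by left; split=> // h; apply: hX; split=> // -[].
Qed.

Lemma exchange_conjugacy :
  {ae leb, forall x : R, 0 <= x <= 1 ->
     interval_exchange mu lambda Phi0 Sstar x != None} /\
  measurable_conjugacy mu leb (subshift S) `[0, 1]
    (@shift_map A) (interval_exchange mu lambda Phi0 Sstar) iso.
Proof.
have n1 := negligible_point 1.
have n2 := negligible_not_two_sided lambda_gt1 lm_ge0 hc2.
have n3 := negligible_not_two_sided lambda_gt1 lm_ge0 hc1.
have mX1 : measurable X1.
  apply: measurableD measurable_iso_right.
  exact: (measurable_two_sided hc1).
have mY1 : measurable Y1.
  apply: measurableD measurable_right_endpoints.
  exact: (measurable_two_sided hc2).
split; last split.
- apply: negligibleS (negligibleU n1 n2) => x /= hx.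
  apply: contrapT => h; apply: hx => /andP[x0 x1].
  have x1' : x < 1.
    by rewrite lt_neqAle x1 andbT; apply/eqP => E; apply: h; left.
  have hI : I01 x by rewrite /= in_itv /= x0.
  apply: exchange_defined => //; apply: contrapT => h2.
  by apply: h; right.
- move=> tau ht; rewrite /= in_itv /=.
  apply: (limPhi_sub01 lambda_gt1 lm_gt0 lm_split hPhi0).
  exact: address_of_infinite.
- split; first exact: measurable_iso.
  move=> B mB.
  exact: etrans (iso_preserves mB) (esym (closed_unit_interval mB)).
- exists X1, Y1; split=> //.
  + by split=> [x [[]]//|x [[/=]]]; rewrite !in_itv /= => /andP[-> /ltW ->].
  + split; apply: measure_negligible.
    * exact: measurableD measurable_subshift mX1.
    * have n4 := negligibleU n3 negligible_iso_right.
      exact: (negligibleS subshift_exceptional n4).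
    * by apply: measurableD mY1; exact: measurable_itv.
    * have n5 := negligibleU n1 (negligibleU n2 negligible_right_endpoints).
      exact: (negligibleS unit_interval_exceptional n5).
  + exact: iso_bij.
- apply: negligibleS (negligibleU n3 negligible_iso_right) => x /= hx.
  apply: contrapT => h; apply: hx => ht; apply: exchange_shift => //.
    by apply: contrapT => h2; apply: h; left.
  by move=> hr; apply: h; right.
Qed.

End Conjugacy.

Theorem theorem4p5 (R : realType) (A : alphabetType) (S : A -> seq A)
    (mu : probability (borel_biseq A) R) (lambda : R)
    (Phi0 : A -> R) (Sstar : dual_substitution S)
    (hS : is_substitution S)
    (hrec : recognizable S)
    (hmin : minimal_subshift S)
    (hSigma : mu (subshift S) = 1%E)
    (hshift : shift_invariant mu)
    (hPF : perron_frobenius_eigenvalue (subst_matrix S R) lambda)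
    (hlambda : 1 < lambda)
    (hpos : forall a : A, (0 < mu (cylinder S a))%E)
    (hscale : forall (a : A) (n : nat),
      mu (iter n (subst_biseq S) @` cylinder S a) =
      (mu (cylinder S a) * (lambda ^- n)%:E)%E)
    (hPhi0 : partition [set: A]
      (fun a => [set` `[Phi0 a, Phi0 a + letter_measure S mu a[]) `[0, 1[) :
  {ae @lebesgue_measure R, forall x : R, 0 <= x <= 1 ->
     interval_exchange mu lambda Phi0 Sstar x != None} /\
  measurable_conjugacy mu (@lebesgue_measure R) (subshift S) `[0, 1]
    (@shift_map A) (interval_exchange mu lambda Phi0 Sstar)
    (canonical_iso mu lambda Phi0 Sstar).
Proof.
exact: (exchange_conjugacy Sstar hS hrec hshift hlambda hpos hscale hPhi0).
Qed.
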